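(* Let $(I,\mathcal{B}(I),\mathcal{L})$ be a standard probability space without atoms, let $d\ge1$, $K=\mathbf{T}^d=(\mathbb{R}/\mathbb{Z})^d$, and let $f:I\to K$ be a measurable map which is asynchronous. Then there exists a set $E\subset\mathbb{Z}$ of full natural density such that for all $\mu\in\mathcal{M}_{\mathcal{L}}$, $$\lim_{n\to\pm\infty,\ n\in E}\ \mathcal{D}_{nf}*\mu=\lambda .$$
   Context: $f:I\to K$ is asynchronous if the image measure $f_*\mathcal{L}$ gives zero mass to every translate of every proper closed subgroup of $K$ (equivalently, for every non-trivial character $\chi\in\hat K$, the measure $(\chi\circ f)_*\mathcal{L}$ has no atoms). $\mathcal{M}_{\mathcal{L}}$ is the set of probability measures on $I\times K$ whose projection to $I$ is $\mathcal{L}$. It is endowed with the weak-* topology: fix a compact metrizable topology on $I$ whose Borel $\sigma$-algebra is $\mathcal{B}(I)$ (for example, identify $(I,\mathcal{L})$ with $[0,1]$ with Lebesgue measure), and take the topology generated by the maps $\mu\mapsto\int F\,d\mu$, $F:I\times K\to\mathbb{C}$ continuous. The resulting topology is compact metrizable and independent of the choice. For a measurable map $g:I\to K$, $\mathcal{D}_g\in\mathcal{M}_{\mathcal{L}}$ is the pushforward of $\mathcal{L}$ by $x\mapsto (x,g(x))$; $nf$ is the map $x\mapsto nf(x)$. Each $\mu\in\mathcal{M}_{\mathcal{L}}$ has a disintegration $(\mu^x)_{x\in I}$ along $\mathcal{L}$ into probability measures on $K$; the fiberwise convolution $\mu*\nu\in\mathcal{M}_{\mathcal{L}}$ is defined by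 $(\mu*\nu)^x=\mu^x*\nu^x$ for $\mathcal{L}$-a.e. $x$. $\lambda=\mathcal{L}\otimes\mathrm{Haar}_K$, with $\mathrm{Haar}_K$ the Haar probability measure. $E\subset\mathbb{Z}$ has full natural density (density one) if $\#(E\cap[-N,N])/(2N+1)\to1$ as $N\to+\infty$. *)

(* Defs.v *)
From HB Require Import structures.
From mathcomp Require Import all_boot all_order all_algebra.
From mathcomp Require Import all_classical all_reals all_analysis.

Set Implicit Arguments.
Unset Strict Implicit.
Unset Printing Implicit Defensive.

Import Order.TTheory GRing.Theory Num.Theory.
Import numFieldNormedType.Exports.

Local Open Scope classical_set_scope.
Local Open Scope ring_scope.

(* [{ideal_quot _}] only needs an additive subgroup to build the quotient
   group; no ideal property of [Z] in [R] is involved. *)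
Definition integers (R : realType) : GRing.ZmodClosed.type R :=
  GRing.ZmodClosed.clone R (@Num.int_num_subdef R) _.

Definition circle (R : realType) : Type := {ideal_quot integers R}.

HB.instance Definition _ (R : realType) :=
  Topological.copy (circle R) (quotient_topology {ideal_quot integers R}).
HB.instance Definition _ (R : realType) :=
  Quotient.copy (circle R) {ideal_quot integers R}.
HB.instance Definition _ (R : realType) :=
  GRing.isZmodule.Build (circle R)
    (@Quotient.addqA R (integers R)) (@Quotient.addqC R (integers R))
    (@Quotient.add0q R (integers R)) (@Quotient.addNq R (integers R)).
HB.instance Definition _ (R : realType) := isPointed.Build (circle R) 0.

Definition torus (R : realType) (d : nat) : Type := 'rV[circle R]_d.

HB.instance Definition _ (R : realType) (d : nat) :=
  GRing.Zmodule.copy (torus R d) 'rV[circle R]_d.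
HB.instance Definition _ (R : realType) (d : nat) :=
  PointedTopological.copy (torus R d) 'rV[circle R]_d.

Fact torus_display : measure_display.
Proof. exact: default_measure_display. Qed.

Section torus_borel.
Context (R : realType) (d : nat).

Definition torus_borel : set (set (torus R d)) := <<s (@open (torus R d)) >>.

Fact torus_borel0 : torus_borel set0. Proof. exact: sigma_algebra0. Qed.

Fact torus_borelC A : torus_borel A -> torus_borel (~` A).
Proof. exact: sigma_algebraC. Qed.

Fact torus_borel_bigcup (F : (set (torus R d))^nat) :
  (forall i, torus_borel (F i)) -> torus_borel (\bigcup_i F i).
Proof. exact: sigma_algebra_bigcup. Qed.

HB.instance Definition _ := @isMeasurable.Build torus_display (torus R d)
  torus_borel torus_borel0 torus_borelC torus_borel_bigcup.

End torus_borel.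

Lemma pi_circleD (R : realType) :
  {morph \pi_(circle R)%qT : x y / x + y >-> x + y}.
Proof. exact: Quotient.pi_add. Qed.

Lemma pi_circleN (R : realType) :
  {morph \pi_(circle R)%qT : x / - x >-> - x}.
Proof. exact: Quotient.pi_opp. Qed.

Lemma pi_circle0 (R : realType) : \pi_(circle R)%qT 0 = 0.
Proof.
by rewrite -[in RHS](subrr (\pi_(circle R)%qT 0)) -pi_circleN -pi_circleD subrr.
Qed.

Lemma pi_circle_mulz (R : realType) (x : R) (n : int) :
  \pi_(circle R)%qT (x *~ n) = \pi_(circle R)%qT x *~ n.
Proof.
have nat_case m : \pi_(circle R)%qT (x *+ m) = \pi_(circle R)%qT x *+ m.
  by elim: m => [|m IH]; rewrite ?mulr0n ?pi_circle0// !mulrS pi_circleD IH.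
by case: n => m; rewrite ?NegzE ?mulrNz -?pmulrn ?pi_circleN nat_case.
Qed.

Section torus_mulz.
Context (R : realType) (d : nat).

Lemma circle_mulz_continuous (n : int) :
  continuous (fun x : circle R => x *~ n).
Proof.
apply/(@quotient_continuous R {ideal_quot integers R} (circle R)).
have -> : (fun x : circle R => x *~ n) \o \pi_(circle R)%qT =
          \pi_(circle R)%qT \o (fun x : R => x *~ n).
  by apply/funext => x /=; rewrite pi_circle_mulz.
move=> x; apply: continuous_comp; last exact: pi_continuous.
have -> : (fun y : R => y *~ n) = ( *%R n%:~R).
  by apply/funext => y; rewrite mulrzl.
exact: mulrl_continuous.
Qed.

Lemma torus_mulzE (n : int) (x : torus R d) i j :
  (x *~ n : torus R d) i j = x i j *~ n.
Proof.
by case: n => m; rewrite ?NegzE ?mulrNz -?pmulrn ?[LHS]mxE mulmxnE.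
Qed.

Lemma torus_mulz_continuous (n : int) :
  continuous (fun x : torus R d => x *~ n).
Proof.
move=> x A [P xP PA].
exists (fun i j => (fun t : circle R => t *~ n) @^-1` P i j).
  move=> i j; apply: circle_mulz_continuous; have := xP i j.
  by rewrite torus_mulzE.
by move=> y yP; apply: PA => i j; have := yP i j; rewrite torus_mulzE.
Qed.

Lemma torus_mulz_measurable (n : int) :
  measurable_fun [set: torus R d] (fun x : torus R d => x *~ n).
Proof.
apply: (@measurability _ _ _ _ _ _ (@open (torus R d))) => //.
move=> _ [A oA <-]; rewrite setTI; apply: sub_sigma_algebra.
by move/continuousP: (@torus_mulz_continuous n); apply.
Qed.

End torus_mulz.

(* [phi] identifies the measurable space [I] with the topological space [X]
   endowed with its Borel sigma-algebra. *)
Definition borel_iso (dI : measure_display) (I : measurableType dI)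
    (X : topologicalType) (phi : I -> X) : Prop :=
  bijective phi /\
  forall A : set I,
    measurable A <-> exists2 B : set X, <<s (@open X) >> B & A = phi @^-1` B.

(* Borel isomorphic to a Polish space. *)
Definition standard_borel (R : realType) (dI : measure_display)
    (I : measurableType dI) : Prop :=
  exists (X : completePseudoMetricType R) (phi : I -> X),
    [/\ hausdorff_space X, @second_countable X & borel_iso phi].

Definition atomless (R : realType) (dI : measure_display)
    (I : measurableType dI) (L : probability I R) : Prop :=
  forall A : set I, measurable A -> (0 < L A)%E ->
    exists B : set I,
      [/\ measurable B, B `<=` A, (0 < L B)%E & (L B < L A)%E].

Definition closed_subgroup (R : realType) (d : nat) (H : set (torus R d)) :=
  [/\ closed H, H 0 & forall x y, H x -> H y -> H (x - y)].

Definition asynchronous (R : realType) (d : nat) (dI : measure_display)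
    (I : measurableType dI) (L : probability I R)
    (f : {mfun I >-> torus R d}) : Prop :=
  forall H : set (torus R d), closed_subgroup H -> H <> setT ->
  forall a : torus R d,
    distribution L f [set a + h | h in H] = 0%E.

Definition is_haar (R : realType) (d : nat)
    (haar : probability (torus R d) R) : Prop :=
  forall (a : torus R d) (A : set (torus R d)), measurable A ->
    haar [set a + x | x in A] = haar A.

Section fibered.
Context (R : realType) (d : nat) (dI : measure_display) (I : measurableType dI).
Variable L : probability I R.
Local Notation K := (torus R d).

Record fibered := Fibered {
  fibered_prob :> probability (I * K)%type R ;
  fibered_marginal : forall A : set I, measurable A ->
    pushforward fibered_prob fst A = L A }.

HB.instance Definition _ := gen_eqMixin fibered.
HB.instance Definition _ := gen_choiceMixin fibered.

Definition mulz_fun (f : I -> K) (n : int) : I -> K := fun x => f x *~ n.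

Fact mulz_fun_measurable (f : {mfun I >-> K}) n :
  measurable_fun [set: I] (mulz_fun f n).
Proof.
apply: (measurableT_comp (@torus_mulz_measurable R d n)).
exact: measurable_funPT.
Qed.

HB.instance Definition _ (f : {mfun I >-> K}) n :=
  isMeasurableFun.Build _ _ _ _ (mulz_fun f n) (mulz_fun_measurable f n).

Definition graph_fun (g : I -> K) : I -> I * K := fun x => (x, g x).

Fact graph_fun_measurable (g : {mfun I >-> K}) :
  measurable_fun [set: I] (graph_fun g).
Proof. by apply: measurable_fun_pair => //; exact: measurable_funPT. Qed.

HB.instance Definition _ (g : {mfun I >-> K}) :=
  isMeasurableFun.Build _ _ _ _ (graph_fun g) (graph_fun_measurable g).

Fact graph_marginal (g : {mfun I >-> K}) (A : set I) : measurable A ->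
  pushforward (distribution L (graph_fun g)) fst A = L A.
Proof. by []. Qed.

Definition graph_measure (g : {mfun I >-> K}) : fibered :=
  Fibered (graph_marginal g).

Fact product_marginal (P : probability K R) (A : set I) : measurable A ->
  pushforward (L \x P)%E fst A = L A.
Proof.
move=> mA; rewrite /pushforward.
have -> : fst @^-1` A = A `*` [set: K].
  by apply/seteqP; split=> -[x y] //= [].
by rewrite product_measure1E// [X in (_ * X)%E]probability_setT mule1.
Qed.

Definition product_fibered (P : probability K R) : fibered :=
  Fibered (product_marginal P).

Definition disintegration (mu : fibered) (k : R.-pker I ~> K) : Prop :=
  forall (A : set I) (B : set K), measurable A -> measurable B ->
    mu (A `*` B) = (\int[L]_(x in A) k x B)%E.

Definition convolution (P Q : {measure set K -> \bar R}) : set K -> \bar R :=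
  pushforward (P \x Q)%E (fun z : K * K => z.1 + z.2).

(* [rho = mu * nu].  Disintegrations are unique up to [L]-null sets, hence the
   choice of [km], [kn], [kr] is immaterial and [rho] is unique as a measure. *)
Definition is_fiberwise_convolution (mu nu rho : fibered) : Prop :=
  exists km kn kr : R.-pker I ~> K,
    [/\ disintegration mu km, disintegration nu kn, disintegration rho kr &
        {ae L, forall x, forall B : set K, measurable B ->
          kr x B = convolution (km x) (kn x) B}].

(* Test functions [F : X * K -> C]; as a topological space, [C] is [R * R]. *)
Definition test_fun (X : topologicalType) : Type :=
  {F : X * K -> R * R | continuous F}.

Definition test_integral (X : topologicalType) (phi : I -> X) (mu : fibered)
    (F : test_fun X) : R * R :=
  ((\int[mu]_z (sval F (phi z.1, z.2)).1)%R,
   (\int[mu]_z (sval F (phi z.1, z.2)).2)%R).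

(* The initial topology of the family of maps [mu |-> \int F dmu]. *)
Definition weak_star (X : topologicalType) (phi : I -> X) : Type :=
  initial_topology
    (test_integral phi : fibered -> {ptws test_fun X -> (R * R)%type}).

HB.instance Definition _ (X : topologicalType) (phi : I -> X) :=
  Topological.copy (weak_star phi)
    (initial_topology
      (test_integral phi : fibered -> {ptws test_fun X -> (R * R)%type})).

Lemma cvg_weak_star (X : topologicalType) (phi : I -> X) (T : Type)
    (F : set_system T) (rho : T -> fibered) (mu : fibered) : Filter F ->
  (rho n : weak_star phi) @[n --> F] --> (mu : weak_star phi) <->
  forall u : test_fun X,
    test_integral phi (rho n) u @[n --> F] --> test_integral phi mu u.
Proof.
pose ptws_test := {ptws test_fun X -> (R * R)%type}.
move=> FF; split=> [h u|h].
  have c : continuous (test_integral phi : weak_star phi -> ptws_test).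
    exact: initial_continuous.
  have := @cvg_comp _ _ _ (fun n => rho n : weak_star phi) _ _ _ _ h (c mu).
  rewrite cvg_sup => /(_ u) h2 A; rewrite nbhsE => -[B [oB Bu] BA].
  pose evB := (fun g : test_fun X -> (R * R)%type => g u) @^-1` B.
  apply: (@filterS _ F FF _ _ _ (h2 evB _)) => [n /=|]; first exact: BA.
  by exists evB; split => //; exists B.
have hptws : (test_integral phi (rho n) : ptws_test) @[n --> F] -->
             (test_integral phi mu : ptws_test).
  apply/cvg_sup => u C [_ [[D oD <-] Dm sDC]].
  have hD := h u D (open_nbhs_nbhs (conj oD Dm)).
  by apply: (@filterS _ F FF _ _ _ hD) => n; exact: sDC.
move=> A [_ [[B oB <-] Bmu sBA]].
have hB := hptws B (open_nbhs_nbhs (conj oB Bmu)).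
by apply: (@filterS _ F FF _ _ _ hB) => n; exact: sBA.
Qed.

End fibered.

Definition full_density (R : realType) (E : set int) : Prop :=
  (#|[pred k : 'I_(N.*2.+1) | (k%:Z - N%:Z) \in E]|%:R / N.*2.+1%:R : R)
    @[N --> \oo] --> (1 : R).

(* The filter "[n] tends to [+oo] or [-oo] along [E]". *)
Definition to_infty_in (E : set int) : set_system int :=
  filter_from [set: nat] (fun N => [set n : int | n \in E /\ (N <= `|n|)%N]).

(* Main.v *)
Require Import Defs.
From HB Require Import structures.
From mathcomp Require Import all_boot all_order all_algebra.
From mathcomp Require Import all_classical all_reals all_analysis.
From mathcomp Require Import measurable_realfun ring lra zify.

(** Real-valued Fourier analysis on the torus [K] carries the proof.  A character
    of [K] is given by an integer vector [m]; its cosine and sine are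
    [torus_cos m] and [torus_sin m].

    Fix [m != 0] and let [theta x] be the value of the character at [f x].  The
    fibers of [theta] are preimages under [f] of cosets of the kernel of the
    character, so asynchrony makes the law of [theta] atomless
    ([asynchronous_char_atomless]).  By Wiener's lemma the squares of the
    coefficients [A_m(n) = \int cos (2 pi n theta)] have Cesaro means tending to
    [0] ([wiener]).  The lemma of Koopman and von Neumann turns the countably
    many sequences [n |-> A_m(n + k) ^ 2] into one set [E] of density one along
    which all of them tend to [0] ([asynchronous_density_set]).

    This single [E] has to serve uncountably many measures [mu].  The product
    formulas write the inner product of [cos (2 pi n theta)] and
    [cos (2 pi k theta)] in terms of [A_m(n + k)] and [A_m(n - k)].  So along [E]
    these functions become orthogonal to each fixed one among them, and a bounded
    sequence of a Hilbert space with that property converges weakly to [0]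
    ([almost_orthogonal_weakly_null]).  Hence [\int h cos (2 pi n theta)] tends
    to [0] along [E] for every bounded [h].

    Let now [rho_n] be the fiberwise convolution of the graph of [n f] with [mu].
    The Fourier coefficient of a convolution is a product of Fourier
    coefficients, and that of the Dirac mass at [n f(x)] is the value of the
    character there.  So the integral against [rho_n] of [1_A(x)] times a
    character has the above form, with [h] the product of [1_A] and a Fourier
    coefficient of the fiber of [mu] ([fiberwise_convolution_cos]).  Its limit [0]
    is also the integral against the product of [L] and Haar measure.

    Sums of functions [1_A(x) p(y)], with [p] a trigonometric polynomial,
    approximate every test function uniformly: this combines the density of
    trigonometric polynomials ([trig_dense], a Stone-Weierstrass argument) with
    the compactness of [X] ([test_function_approx]).  The same approximation
    shows that test functions are measurable for the product sigma-algebra. *)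

Set Implicit Arguments.
Unset Strict Implicit.
Unset Printing Implicit Defensive.

Import Order.TTheory GRing.Theory Num.Theory.
Import numFieldNormedType.Exports.

Local Open Scope classical_set_scope.
Local Open Scope ring_scope.

(** * Cosine and sine on the circle *)

Section circle_functions.
Context {R : realType}.
Local Notation pic := (\pi_(circle R)%qT).
Local Notation turn := (pi *+ 2 : R).

Definition circle_cos (t : circle R) : R := cos (turn * repr t).
Definition circle_sin (t : circle R) : R := sin (turn * repr t).

Lemma pi_circle_eq (x y : R) : pic x = pic y <-> x - y \is a Num.int.
Proof.
rewrite -[_ \is a _]/(x - y \in integers R) Quotient.idealrBE.
split=> [h|/eqP h]; last exact: h.
by apply/eqP; exact: h.
Qed.

Lemma cos_turn_int (z : int) (x : R) : cos (turn * (x + z%:~R)) = cos (turn * x).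
Proof.
have nat_case n y : cos (turn * (y + n%:R)) = cos (turn * y).
  by rewrite mulrDr mulr_natr (periodicn (@cosD2pi R)).
case: z => n; first exact: nat_case.
by rewrite NegzE mulrNz -(nat_case n.+1) subrK.
Qed.

Lemma sin_turn_int (z : int) (x : R) : sin (turn * (x + z%:~R)) = sin (turn * x).
Proof.
have nat_case n y : sin (turn * (y + n%:R)) = sin (turn * y).
  by rewrite mulrDr mulr_natr (periodicn (@sinD2pi R)).
case: z => n; first exact: nat_case.
by rewrite NegzE mulrNz -(nat_case n.+1) subrK.
Qed.

Lemma circle_repr (x : R) : exists z : int, repr (pic x) = x + z%:~R.
Proof.
have /pi_circle_eq/intrP[z xz] : pic (repr (pic x)) = pic x by rewrite reprK.
by exists z; rewrite -xz addrC subrK.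
Qed.

Lemma circle_cosE (x : R) : circle_cos (pic x) = cos (turn * x).
Proof. by have [z xz] := circle_repr x; rewrite /circle_cos xz cos_turn_int. Qed.

Lemma circle_sinE (x : R) : circle_sin (pic x) = sin (turn * x).
Proof. by have [z xz] := circle_repr x; rewrite /circle_sin xz sin_turn_int. Qed.

Lemma circle_ind (P : circle R -> Prop) : (forall x, P (pic x)) -> forall t, P t.
Proof. by move=> h t; rewrite -[t]reprK. Qed.

Lemma circle_cosD s t :
  circle_cos (s + t) = circle_cos s * circle_cos t - circle_sin s * circle_sin t.
Proof.
elim/circle_ind: s => x; elim/circle_ind: t => y.
by rewrite -pi_circleD !circle_cosE !circle_sinE mulrDr cosD.
Qed.

Lemma circle_sinD s t :
  circle_sin (s + t) = circle_sin s * circle_cos t + circle_cos s * circle_sin t.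
Proof.
elim/circle_ind: s => x; elim/circle_ind: t => y.
by rewrite -pi_circleD !circle_cosE !circle_sinE mulrDr sinD.
Qed.

Lemma circle_cosN t : circle_cos (- t) = circle_cos t.
Proof.
by elim/circle_ind: t => x; rewrite -pi_circleN !circle_cosE mulrN cosN.
Qed.

Lemma circle_sinN t : circle_sin (- t) = - circle_sin t.
Proof.
by elim/circle_ind: t => x; rewrite -pi_circleN !circle_sinE mulrN sinN.
Qed.

Lemma circle_cos0 : circle_cos 0 = 1.
Proof. by rewrite -pi_circle0 circle_cosE mulr0 cos0. Qed.

Lemma circle_sin0 : circle_sin 0 = 0.
Proof. by rewrite -pi_circle0 circle_sinE mulr0 sin0. Qed.

Lemma circle_cos2Dsin2 t : circle_cos t ^+ 2 + circle_sin t ^+ 2 = 1.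
Proof. exact: cos2Dsin2. Qed.

Lemma circle_cos_max t : `|circle_cos t| <= 1. Proof. exact: cos_max. Qed.

Lemma circle_sin_max t : `|circle_sin t| <= 1. Proof. exact: sin_max. Qed.

(** Reduce to a representative [u] in [[0, 1)]: there
    [cos (2 pi u) = 1 - 2 sin (pi u) ^ 2], and the sine vanishes only at [0]. *)
Lemma circle_cos_eq1 t : circle_cos t = 1 -> t = 0.
Proof.
elim/circle_ind: t => x; set u := x - (Num.floor x)%:~R.
have -> : pic x = pic u.
  by apply/pi_circle_eq; rewrite /u opprB addrC subrK; apply: intr_int.
have /andP[u0 u1] : 0 <= u < 1.
  by rewrite /u subr_ge0 ltrBlDl floor_le/= -intrD1 floorD1_gt.
rewrite circle_cosE mulrnAl cos_mulr2n => cos1.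
have sin0 : sin (pi * u) = 0.
  by apply/eqP; rewrite -(sqrf_eq0 (sin _)) sin2cos2; apply/eqP; lra.
move: u0; rewrite le_eqVlt => /predU1P[<-|u0]; first exact: pi_circle0.
have : 0 < sin (pi * u) by rewrite sin_gt0_pi// mulr_gt0 ?pi_gt0//= gtr_pMr ?pi_gt0.
by rewrite sin0 ltxx.
Qed.

Lemma circle_cos_continuous : continuous circle_cos.
Proof.
apply/(@quotient_continuous R {ideal_quot integers R} _ circle_cos).
have -> : circle_cos \o pic = (fun x : R => cos (turn * x)).
  by apply/funext => x /=; rewrite circle_cosE.
by move=> x; apply: continuous_comp; [exact: mulrl_continuous|exact: continuous_cos].
Qed.

Lemma circle_sin_continuous : continuous circle_sin.
Proof.
apply/(@quotient_continuous R {ideal_quot integers R} _ circle_sin).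
have -> : circle_sin \o pic = (fun x : R => sin (turn * x)).
  by apply/funext => x /=; rewrite circle_sinE.
by move=> x; apply: continuous_comp; [exact: mulrl_continuous|exact: continuous_sin].
Qed.

Lemma circle_compact : compact [set: circle R].
Proof.
have -> : [set: circle R] = pic @` `[0, 1]%classic.
  apply/seteqP; split=> // t _; elim/circle_ind: t => x.
  exists (x - (Num.floor x)%:~R) => /=.
    by rewrite in_itv/= subr_ge0 floor_le/= lerBlDl ltW// -intrD1 floorD1_gt.
  by apply/pi_circle_eq; rewrite addrC addKr -mulrNz; apply: intr_int.
apply: continuous_compact; last exact: segment_compact.
by apply: continuous_subspaceT => x; exact: pi_continuous.
Qed.

Lemma circle_translation_continuous (s : circle R) : continuous (fun t => s + t).
Proof.
elim/circle_ind: s => x.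
apply/(@quotient_continuous R {ideal_quot integers R} _ (fun t => pic x + t)).
have -> : (fun t => pic x + t) \o pic = pic \o (fun y : R => x + y).
  by apply/funext => y /=; rewrite pi_circleD.
move=> y; apply: continuous_comp; last exact: pi_continuous.
by apply: cvgD; [exact: cvg_cst|exact: cvg_id].
Qed.

End circle_functions.

(** * Characters of the torus *)

Section torus_characters.
Context {R : realType} {d : nat}.
Local Notation K := (torus R d).
Local Notation pic := (\pi_(circle R)%qT).

Definition torus_char (m : 'rV[int]_d) (x : K) : circle R :=
  \sum_j x ord0 j *~ m ord0 j.

Definition torus_cos m (x : K) : R := circle_cos (torus_char m x).
Definition torus_sin m (x : K) : R := circle_sin (torus_char m x).

Lemma torus_charD m (x y : K) :
  torus_char m (x + y) = torus_char m x + torus_char m y.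
Proof. by rewrite -big_split/=; apply: eq_bigr => j _; rewrite mxE mulrzDl. Qed.

Lemma torus_charN m (x : K) : torus_char m (- x) = - torus_char m x.
Proof. by rewrite -sumrN; apply: eq_bigr => j _; rewrite mxE mulNrz. Qed.

Lemma torus_char_mulz m (x : K) (n : int) :
  torus_char m (x *~ n) = torus_char m x *~ n.
Proof.
rewrite mulrz_suml; apply: eq_bigr => j _.
by rewrite torus_mulzE -!mulrzA mulrC.
Qed.

Lemma torus_charDl m m' (x : K) :
  torus_char (m + m') x = torus_char m x + torus_char m' x.
Proof. by rewrite -big_split/=; apply: eq_bigr => j _; rewrite mxE mulrzDr. Qed.

Lemma torus_charNl m (x : K) : torus_char (- m) x = - torus_char m x.
Proof. by rewrite -sumrN; apply: eq_bigr => j _; rewrite mxE mulrNz. Qed.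

Lemma torus_char0l (x : K) : torus_char 0 x = 0.
Proof. by rewrite /torus_char big1// => j _; rewrite mxE mulr0z. Qed.

Lemma torus_char0r m : torus_char m (0 : K) = 0.
Proof. by rewrite /torus_char big1// => j _; rewrite mxE mul0rz. Qed.

Lemma torus_char_delta j (x : K) : torus_char (delta_mx ord0 j) x = x ord0 j.
Proof.
rewrite /torus_char (bigD1 j)//= mxE !eqxx mulr1z big1 ?addr0// => i ij.
by rewrite mxE (negPf ij) mulr0z.
Qed.

(** Divide by a nonzero coordinate of [m]. *)
Lemma torus_char_surj (m : 'rV[int]_d) t : m != 0 -> exists a : K, torus_char m a = t.
Proof.
move=> /rV0Pn[j mj]; elim/(@circle_ind R): t => r.
have mjR : (m ord0 j)%:~R != 0 :> R by rewrite intr_eq0.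
exists (\row_i if i == j then pic (r / (m ord0 j)%:~R) else 0).
rewrite /torus_char (bigD1 j)//= mxE eqxx big1 ?addr0 => [|i ij].
  apply: etrans (esym (pi_circle_mulz _ _)) _.
  by rewrite -mulrzr divfK.
by rewrite mxE (negPf ij) mul0rz.
Qed.

(** The characters dual to the coordinates suffice. *)
Lemma torus_char_separates (x y : K) :
  (forall m, torus_cos m x = torus_cos m y) ->
  (forall m, torus_sin m x = torus_sin m y) -> x = y.
Proof.
move=> c s; apply/rowP => j; apply/subr0_eq; apply: circle_cos_eq1.
have := c (delta_mx ord0 j); have := s (delta_mx ord0 j).
rewrite /torus_cos /torus_sin !torus_char_delta => sj cj.
by rewrite circle_cosD circle_cosN circle_sinN sj cj mulrN opprK -!expr2 circle_cos2Dsin2.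
Qed.

Lemma torus_coord_continuous j : continuous (fun x : K => x ord0 j).
Proof.
move=> x A xA; exists (fun i k => if k == j then A else setT).
  by move=> i k; case: eqP => [->|_]; rewrite ?ord1//; exact: filterT.
by move=> y /(_ ord0 j); rewrite eqxx.
Qed.

(** Cosine and sine are treated together because the addition formulas mix them
    in the induction over the coordinates. *)
Lemma torus_cos_sin_continuous m :
  continuous (torus_cos m) /\ continuous (torus_sin m).
Proof.
have term_continuous j : continuous (fun x : K => x ord0 j *~ m ord0 j).
  move=> x; apply: (@continuous_comp K (circle R) (circle R)
    (fun x : K => x ord0 j) (fun t => t *~ m ord0 j)).
    exact: torus_coord_continuous.
  exact: circle_mulz_continuous.
suff sum_continuous (s : seq 'I_d) :
    continuous (fun x : K => circle_cos (\sum_(j <- s) x ord0 j *~ m ord0 j)) /\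
    continuous (fun x : K => circle_sin (\sum_(j <- s) x ord0 j *~ m ord0 j)).
  exact: sum_continuous.
elim: s => [|j s [IHc IHs]].
  split; [have -> : (fun x : K => circle_cos (\sum_(j <- [::]) x ord0 j *~ m ord0 j))
                   = cst 1 by apply/funext => x; rewrite big_nil circle_cos0
         |have -> : (fun x : K => circle_sin (\sum_(j <- [::]) x ord0 j *~ m ord0 j))
                   = cst 0 by apply/funext => x; rewrite big_nil circle_sin0];
    exact: cst_continuous.
have cc x : {for x, continuous (fun x : K => circle_cos (x ord0 j *~ m ord0 j))}.
  apply: (@continuous_comp K (circle R) R); first exact: term_continuous.
  exact: circle_cos_continuous.
have cs x : {for x, continuous (fun x : K => circle_sin (x ord0 j *~ m ord0 j))}.
  apply: (@continuous_comp K (circle R) R); first exact: term_continuous.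
  exact: circle_sin_continuous.
pose c j (x : K) := circle_cos (x ord0 j *~ m ord0 j).
pose s' j (x : K) := circle_sin (x ord0 j *~ m ord0 j).
pose C (x : K) := circle_cos (\sum_(j <- s) x ord0 j *~ m ord0 j).
pose S (x : K) := circle_sin (\sum_(j <- s) x ord0 j *~ m ord0 j).
split.
  have -> : (fun x : K => circle_cos (\sum_(j <- j :: s) x ord0 j *~ m ord0 j)) =
      (c j \* C \- s' j \* S)%R.
    by apply/funext => x; rewrite big_cons circle_cosD.
  by move=> x; exact: (cvgB (cvgM (@cc x) (IHc x)) (cvgM (@cs x) (IHs x))).
have -> : (fun x : K => circle_sin (\sum_(j <- j :: s) x ord0 j *~ m ord0 j)) =
    (s' j \* C \+ c j \* S)%R.
  by apply/funext => x; rewrite big_cons circle_sinD.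
by move=> x; exact: (cvgD (cvgM (@cs x) (IHc x)) (cvgM (@cc x) (IHs x))).
Qed.

Lemma torus_compact : compact [set: K].
Proof.
have := @rV_compact (circle R) d (fun=> setT) (fun=> @circle_compact R).
by congr compact; apply/seteqP.
Qed.

Lemma torus_translation_continuous (a : K) : continuous (fun x : K => a + x).
Proof.
move=> x A [P xP PA].
exists (fun i j => (fun t : circle R => a i j + t) @^-1` P i j).
  move=> i j; apply: circle_translation_continuous; have := xP i j.
  by rewrite mxE.
by move=> y yP; apply: PA => i j; have := yP i j; rewrite mxE.
Qed.

Lemma torus_continuous_measurable (g : K -> R) :
  continuous g -> measurable_fun setT g.
Proof.
move=> cg; apply: (measurability _ (measurable_realfun.RGenOpens.measurableE R)).
move=> _ [_ [a [b ->]] <-]; rewrite setTI; apply: sub_sigma_algebra.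
by move/continuousP: cg; apply; exact: interval_open.
Qed.

Lemma torus_translation_measurable (a : K) :
  measurable_fun setT (fun x : K => a + x).
Proof.
apply: (@measurability _ _ _ _ _ _ (@open K)) => //.
move=> _ [A oA <-]; rewrite setTI; apply: sub_sigma_algebra.
by move/continuousP: (@torus_translation_continuous a); apply.
Qed.

End torus_characters.

(** * Stone-Weierstrass approximation on the torus *)

Section lattice_stone_weierstrass.
Context {R : realType} {T : topologicalType}.
Hypothesis T_compact : compact [set: T].

(** A finite subcover of the sets where [G < g] would give finitely many [g],
    whose maximum works.  Here the covering form of compactness is applied to the
    filter of upper sections of the directed family [W], which makes the choice
    of the maximum implicit. *)
Lemma compact_upper_bound (W : set (T -> R)) (G : T -> R) :
  W !=set0 -> (forall f g, W f -> W g -> W (f \max g)) ->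
  (forall b : T, exists2 g, W g & \forall y \near b, G y < g y) ->
  exists2 g, W g & forall y, G y < g y.
Proof.
move=> [w0 Ww0] Wmax Wnear.
pose up (g : T -> R) := [set g' | W g' /\ forall y, g y <= g' y].
have up_filter : Filter (filter_from W up).
  apply: filter_from_filter; first by exists w0.
  move=> f g Wf Wg; exists (f \max g); first exact: Wmax.
  move=> h [Wh fgh]; split; split=> // y; apply: le_trans (fgh y) => /=.
    by rewrite le_max lexx.
  by rewrite le_max lexx orbT.
have /compact_near_coveringP/(_ _ (filter_from W up)
    (fun g y => G y < g y) up_filter) := T_compact.
case.
  move=> x _; have [g Wg gx] := Wnear x.
  exists ([set y | G y < g y], up g).
    by split=> //=; exists g.
  by move=> [y h] /= [Gy [_ gh]]; apply: lt_le_trans Gy (gh y).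
by move=> g Wg gP; exists g => // y; apply: (gP g).
Qed.

(** The lattice form of the Stone-Weierstrass theorem.  For a fixed point [a], a
    maximum of interpolants gives a function above [F - e] everywhere and below
    [F + e] at [a]; a minimum of such functions over [a] is then close to [F]
    everywhere. *)
Lemma lattice_dense (t0 : T) (W : set (T -> R)) (F : T -> R) :
  continuous F -> (forall g, W g -> continuous g) ->
  (forall f g, W f -> W g -> W (f \max g)) ->
  (forall f g, W f -> W g -> W (f \min g)) ->
  (forall a b e, 0 < e ->
    exists2 g, W g & `|g a - F a| < e /\ `|g b - F b| < e) ->
  forall e, 0 < e -> exists2 g, W g & forall y, `|g y - F y| < e.
Proof.
move=> cF cW Wmax Wmin interp e e0.
have near_lt (f : T -> R) x c : continuous f -> f x < c ->
    \forall y \near x, f y < c.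
  by move=> cf fx; exact: (cf x _ (lt_nbhsl fx)).
have near_gt (f : T -> R) x c : continuous f -> c < f x ->
    \forall y \near x, c < f y.
  by move=> cf fx; exact: (cf x _ (lt_nbhsr fx)).
have above a : exists2 g, W g /\ g a < F a + e & forall y, F y - e < g y.
  apply: compact_upper_bound.
  - have [g Wg [ga _]] := interp a a e e0; exists g; split=> //.
    by move: ga; rewrite ltr_norml => /andP[_]; rewrite ltrBlDl.
  - move=> f g [Wf fa] [Wg ga]; split; first exact: Wmax.
    by rewrite /= gt_max fa ga.
  - move=> b; have [g Wg [ga gb]] := interp a b e e0.
    exists g; first by split=> //; move: ga; rewrite ltr_norml; lra.
    have : g b - F b > - e by move: gb; rewrite ltr_norml => /andP[].
    have := @near_gt (g \- F) b (- e).
    move=> /[apply] h; have {h} : \forall y \near b, - e < g y - F y.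
      by apply: h => x; exact: (cvgB (cW _ Wg x) (cF x)).
    by apply: filterS => y; lra.
have [g [h [Wh Fh] gh] gF] : exists2 g,
    (exists2 h, W h /\ (forall y, F y - e < h y) & g = \- h) &
    forall y, - F y - e < g y.
  apply: compact_upper_bound.
  - by have [h Wh Fh] := above t0; exists (\- h), h => //; case: Wh.
  - move=> _ _ [f [Wf Ff] ->] [g [Wg Fg] ->]; exists (f \min g).
      by split=> [|y]; [exact: Wmin|rewrite /= lt_min Ff Fg].
    by apply/funext => y /=; rewrite oppr_min.
  - move=> b; have [g [Wg gb] Fg] := above b.
    exists (\- g); first by exists g.
    have gb' : g b - F b < e by lra.
    have := @near_lt (g \- F) b e.
    move=> h; have {h} : \forall y \near b, g y - F y < e.
      by apply: h => // x; exact: (cvgB (cW _ Wg x) (cF x)).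
    by apply: filterS => y /=; lra.
exists h => // y; have := gF y; rewrite gh /= => hF.
by rewrite ltr_norml; have := Fh y; lra.
Qed.

End lattice_stone_weierstrass.

Section abs_approximation.
Context {R : realType}.

(** The classical recursion approximating [`|x|] on [[-1, 1]] by polynomials in
    [x]: the error [`|x| - q] is multiplied by [1 - (`|x| + q) / 2]. *)
Fixpoint abs_iter n (x : R) : R :=
  if n is k.+1 then abs_iter k x + (x ^+ 2 - abs_iter k x ^+ 2) / 2 else 0.

Lemma abs_iterP n (x : R) : `|x| <= 1 ->
  [/\ 0 <= abs_iter n x, abs_iter n x <= `|x| & `|x| - abs_iter n x <= 2 / n.+2%:R].
Proof.
move=> x1; elim: n => [|n [p0 px pn]] /=.
  by split=> //; rewrite subr0 divff.
rewrite -[x ^+ 2]real_normK ?num_real//.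
move: x1 p0 px pn; set p := abs_iter n x; set y := `|x| => y1 p0 px pn.
have y0 : 0 <= y by exact: normr_ge0.
have -> : y - (p + (y ^+ 2 - p ^+ 2) / 2) = (y - p) * (1 - (y + p) / 2) by field.
have yp0 : 0 <= (y - p) * (y + p) by rewrite mulr_ge0 ?subr_ge0 ?addr_ge0.
have yp1 : 0 <= (y - p) * (1 - (y + p) / 2).
  by rewrite mulr_ge0 ?subr_ge0//; lra.
split; [by lra|by lra|].
have n0 : 0 < n.+2%:R :> R by rewrite ltr0n.
rewrite -natr1; set k : R := n.+2%:R in pn n0 *.
have h1 : (y - p) * (1 - (y + p) / 2) <= (y - p) * (1 - (y - p) / 2).
  by apply: ler_wpM2l; [rewrite subr_ge0|lra].
apply: le_trans h1 _; set u := y - p in pn *.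
have u0 : 0 <= u by rewrite subr_ge0.
have k2 : 2 <= k by rewrite /k ler_nat.
rewrite ler_pdivlMr ?addr_gt0//.
move: pn; rewrite ler_pdivlMr// => pn.
have u1 : u <= 1 by rewrite /u; lra.
have := ler_wpM2r (_ : 0 <= 1 - u / 2) pn.
move=> /(_ ltac:(lra)).
nra.
Qed.

End abs_approximation.

Section torus_stone_weierstrass.
Context {R : realType} {d : nat}.
Local Notation K := (torus R d).

Inductive trig_poly : (K -> R) -> Prop :=
| trig_cos m : trig_poly (torus_cos m)
| trig_sin m : trig_poly (torus_sin m)
| trig_add p q : trig_poly p -> trig_poly q -> trig_poly (p \+ q)
| trig_scale c p : trig_poly p -> trig_poly (c \*o p).

Lemma trig_cst c : trig_poly (cst c).
Proof.
have -> : cst c = c \*o torus_cos (0 : 'rV[int]_d) :> (K -> R).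
  by apply/funext => x; rewrite /= /torus_cos torus_char0l circle_cos0 mulr1.
exact/trig_scale/trig_cos.
Qed.

Lemma trig_sub p q : trig_poly p -> trig_poly q -> trig_poly (p \- q).
Proof.
move=> tp tq; have -> : p \- q = p \+ (-1 \*o q).
  by apply/funext => x; rewrite /= mulN1r.
exact/trig_add/trig_scale.
Qed.

Lemma trig_mul_cos m (p : K -> R) : trig_poly p -> trig_poly (torus_cos m \* p).
Proof.
elim=> [m'|m'|{}p q _ tp _ tq|c {}p _ tp].
- have -> : torus_cos m \* torus_cos m' =
      2^-1 \*o (torus_cos (m + m') \+ torus_cos (m - m')) :> (K -> R).
    apply/funext => x; rewrite /torus_cos /= !torus_charDl torus_charNl.
    by rewrite !circle_cosD circle_cosN circle_sinN; field.
  by apply/trig_scale/trig_add; exact: trig_cos.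
- have -> : torus_cos m \* torus_sin m' =
      2^-1 \*o (torus_sin (m + m') \- torus_sin (m - m')) :> (K -> R).
    apply/funext => x; rewrite /torus_cos /torus_sin /= !torus_charDl torus_charNl.
    by rewrite !circle_sinD circle_cosN circle_sinN; field.
  by apply/trig_scale/trig_sub; exact: trig_sin.
- have -> : torus_cos m \* (p \+ q) = (torus_cos m \* p) \+ (torus_cos m \* q).
    by apply/funext => x; rewrite /= mulrDr.
  exact: trig_add.
- have -> : torus_cos m \* (c \*o p) = c \*o (torus_cos m \* p).
    by apply/funext => x; rewrite /= mulrCA.
  exact: trig_scale.
Qed.

Lemma trig_mul_sin m (p : K -> R) : trig_poly p -> trig_poly (torus_sin m \* p).
Proof.
elim=> [m'|m'|{}p q _ tp _ tq|c {}p _ tp].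
- have -> : torus_sin m \* torus_cos m' =
      2^-1 \*o (torus_sin (m + m') \+ torus_sin (m - m')) :> (K -> R).
    apply/funext => x; rewrite /torus_cos /torus_sin /= !torus_charDl torus_charNl.
    by rewrite !circle_sinD circle_cosN circle_sinN; field.
  by apply/trig_scale/trig_add; exact: trig_sin.
- have -> : torus_sin m \* torus_sin m' =
      2^-1 \*o (torus_cos (m - m') \- torus_cos (m + m')) :> (K -> R).
    apply/funext => x; rewrite /torus_cos /torus_sin /= !torus_charDl torus_charNl.
    by rewrite !circle_cosD circle_cosN circle_sinN; field.
  by apply/trig_scale/trig_sub; exact: trig_cos.
- have -> : torus_sin m \* (p \+ q) = (torus_sin m \* p) \+ (torus_sin m \* q).
    by apply/funext => x; rewrite /= mulrDr.
  exact: trig_add.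
- have -> : torus_sin m \* (c \*o p) = c \*o (torus_sin m \* p).
    by apply/funext => x; rewrite /= mulrCA.
  exact: trig_scale.
Qed.

Lemma trig_mul p q : trig_poly p -> trig_poly q -> trig_poly (p \* q).
Proof.
elim=> [m|m|{}p p' _ tp _ tp'|c {}p _ tp] tq.
- exact: trig_mul_cos.
- exact: trig_mul_sin.
- have -> : (p \+ p') \* q = (p \* q) \+ (p' \* q).
    by apply/funext => x; rewrite /= mulrDl.
  by apply: trig_add; [exact: tp|exact: tp'].
- have -> : (c \*o p) \* q = c \*o (p \* q).
    by apply/funext => x; rewrite /= mulrA.
  by apply: trig_scale; exact: tp.
Qed.

Lemma trig_continuous p : trig_poly p -> continuous p.
Proof.
elim=> [m|m|{}p q _ tp _ tq|c {}p _ tp].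
- exact: (torus_cos_sin_continuous m).1.
- exact: (torus_cos_sin_continuous m).2.
- by move=> x; exact: (cvgD (tp x) (tq x)).
- by move=> x; exact: (cvgM (cvg_cst c) (tp x)).
Qed.

Lemma trig_bounded p : trig_poly p -> exists2 M, 0 < M & forall x, `|p x| <= M.
Proof.
elim=> [m|m|{}p q _ [M M0 pM] _ [N N0 qN]|c {}p _ [M M0 pM]].
- by exists 1 => // x; exact: circle_cos_max.
- by exists 1 => // x; exact: circle_sin_max.
- exists (M + N); first exact: addr_gt0.
  by move=> x; rewrite (le_trans (ler_normD _ _))// lerD.
- exists (`|c| * M + 1) => [|x]; first by rewrite ltr_wpDl// mulr_ge0// ltW.
  by rewrite /= normrM (le_trans (ler_wpM2l _ (pM x)))// lerDl.
Qed.

(** Rescaled to [[-1, 1]], the polynomials [abs_iter n] act on [p] within the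
    algebra of trigonometric polynomials. *)
Lemma trig_abs_approx p e : trig_poly p -> 0 < e ->
  exists2 q, trig_poly q & forall x, `| `|p x| - q x | < e.
Proof.
move=> tp e0; have [M M0 pM] := trig_bounded tp.
have [n n_large] : exists n : nat, M * 2 / e < n%:R.
  by exists (Num.bound (M * 2 / e)); rewrite archi_boundP// divr_ge0 ?mulr_ge0 ?ltW.
exists (M \*o (abs_iter n \o (M^-1 \*o p))).
  apply: trig_scale.
  elim: n {n_large} => [|n IH]; first exact: trig_cst.
  have -> : abs_iter n.+1 \o (M^-1 \*o p) = (abs_iter n \o (M^-1 \*o p)) \+
      2^-1 \*o (((M^-1 \*o p) \* (M^-1 \*o p)) \-
        ((abs_iter n \o (M^-1 \*o p)) \* (abs_iter n \o (M^-1 \*o p)))).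
    by apply/funext => x; rewrite /= -!expr2 (mulrC 2^-1).
  apply: trig_add => //; apply: trig_scale; apply: trig_sub; apply: trig_mul => //;
    exact: trig_scale.
move=> x; set y := M^-1 * p x.
have y1 : `|y| <= 1.
  by rewrite normrM gtr0_norm ?invr_gt0// mulrC ler_pdivrMr// mul1r.
have pxE : `|p x| = M * `|y|.
  by rewrite -[in RHS](gtr0_norm M0) -normrM mulrA divff ?gt_eqF// mul1r.
rewrite /= pxE -mulrBr normrM gtr0_norm//.
have [q0 qy yq] := abs_iterP n y1.
rewrite ger0_norm ?subr_ge0//; apply: le_lt_trans (ler_wpM2l (ltW M0) yq) _.
rewrite mulrA ltr_pdivrMr ?ltr0n//; move: n_large; rewrite ltr_pdivrMr// => /lt_le_trans; apply.
by rewrite mulrC ler_pM2l// ler_nat leqW.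
Qed.

End torus_stone_weierstrass.

Section torus_density.
Context {R : realType} {d : nat}.
Local Notation K := (torus R d).

Definition trig_closure : set (K -> R) := [set g |
  continuous g /\
  forall e, 0 < e -> exists2 p, trig_poly p & forall x, `|g x - p x| < e].

Lemma trig_closure_trig p : trig_poly p -> trig_closure p.
Proof.
move=> tp; split=> [|e e0]; first exact: trig_continuous.
by exists p => // x; rewrite subrr normr0.
Qed.

Lemma trig_closureD f g :
  trig_closure f -> trig_closure g -> trig_closure (f \+ g).
Proof.
move=> [cf fP] [cg gP]; split=> [x|e e0]; first exact: (cvgD (cf x) (cg x)).
have e20 : 0 < e / 2 by rewrite divr_gt0.
have [p tp pf] := fP _ e20; have [q tq qg] := gP _ e20.
exists (p \+ q); first exact: trig_add.
move=> x; rewrite /= opprD addrACA (le_lt_trans (ler_normD _ _))//.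
by rewrite (splitr e) ltrD.
Qed.

Lemma trig_closureZ c f : trig_closure f -> trig_closure (c \*o f).
Proof.
move=> [cf fP]; split=> [x|e e0]; first exact: (cvgM (cvg_cst c) (cf x)).
have e20 : 0 < e / (`|c| + 1) by rewrite divr_gt0// ltr_wpDl.
have [p tp pf] := fP _ e20.
exists (c \*o p); first exact: trig_scale.
move=> x; rewrite /= -mulrBr normrM.
have := pf x; rewrite ltr_pdivlMr ?ltr_wpDl// mulrDr mulr1 mulrC.
by apply: le_lt_trans; rewrite lerDl.
Qed.

Lemma trig_closure_abs f : trig_closure f -> trig_closure (fun x => `|f x|).
Proof.
move=> [cf fP]; split=> [x|e e0].
  by apply: (@continuous_comp K R R f (fun y => `|y|)); [exact: cf|exact: norm_continuous].
have e20 : 0 < e / 2 by rewrite divr_gt0.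
have [p tp pf] := fP _ e20; have [q tq qp] := trig_abs_approx tp e20.
exists q => // x; rewrite -(subrKA `|p x|) (le_lt_trans (ler_normD _ _))//.
by rewrite (splitr e) ltrD// (le_lt_trans (ler_dist_dist _ _)).
Qed.

Lemma trig_closure_max f g :
  trig_closure f -> trig_closure g -> trig_closure (f \max g).
Proof.
move=> Wf Wg; have -> : f \max g =
    2^-1 \*o (f \+ g \+ (fun x => `|(f \+ (-1 \*o g)) x|)).
  by apply/funext => x; rewrite /= maxr_absE mulN1r mulrC.
apply: trig_closureZ; apply: trig_closureD; first exact: trig_closureD.
by apply/trig_closure_abs/trig_closureD => //; exact: trig_closureZ.
Qed.

Lemma trig_closure_min f g :
  trig_closure f -> trig_closure g -> trig_closure (f \min g).
Proof.
move=> Wf Wg; have -> : f \min g =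
    2^-1 \*o (f \+ g \+ (-1 \*o (fun x => `|(f \+ (-1 \*o g)) x|))).
  by apply/funext => x; rewrite /= minr_absE !mulN1r mulrC.
apply: trig_closureZ; apply: trig_closureD; first exact: trig_closureD.
by apply/trig_closureZ/trig_closure_abs/trig_closureD => //; exact: trig_closureZ.
Qed.

Lemma trig_interpolation (a b : K) (u v : R) : a <> b ->
  exists2 p, trig_poly p & p a = u /\ p b = v.
Proof.
move=> ab.
have [p tp pab] : exists2 p : K -> R, trig_poly p & p a != p b.
  apply: contrapT => nP; apply: ab; apply: torus_char_separates => m.
    apply: contrapT => /eqP pab; apply: nP.
    by exists (torus_cos m) => //; exact: trig_cos.
  apply: contrapT => /eqP pab; apply: nP.
  by exists (torus_sin m) => //; exact: trig_sin.
have pab0 : p b - p a != 0 by rewrite subr_eq0 eq_sym.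
exists (cst u \+ ((v - u) / (p b - p a)) \*o (p \- cst (p a))).
  apply/trig_add/trig_scale/trig_sub => //; exact: trig_cst.
by rewrite /= subrr mulr0 addr0 divfK// addrC subrK.
Qed.

Theorem trig_dense (F : K -> R) e : continuous F -> 0 < e ->
  exists2 p, trig_poly p & forall x, `|F x - p x| < e.
Proof.
move=> cF e0; have e20 : 0 < e / 2 by rewrite divr_gt0.
have [|||a b e' e'0|g [cg gP] gF] :=
  @lattice_dense R K torus_compact 0 trig_closure F cF _ _ _ _ (e / 2) e20.
- by move=> g [].
- exact: trig_closure_max.
- exact: trig_closure_min.
- have [<-|ab] := pselect (a = b).
    exists (cst (F a)); first exact/trig_closure_trig/trig_cst.
    by rewrite /= subrr normr0.
  have [p tp [pa pb]] := trig_interpolation (F a) (F b) ab.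
  exists p; first exact: trig_closure_trig.
  by rewrite pa pb !subrr normr0.
have [p tp pg] := gP _ e20; exists p => // x.
rewrite -(subrKA (g x)) (le_lt_trans (ler_normD _ _))//.
by rewrite (splitr e) ltrD// distrC.
Qed.

End torus_density.

(** * Integrals of bounded measurable functions *)

Section bounded_measurable.
Context {R : realType} {dT : measure_display} {T : measurableType dT}.
Implicit Types g h : T -> R.

Definition bounded_measurable g :=
  measurable_fun setT g /\ exists M, forall x, `|g x| <= M.

Lemma bounded_measurable_cst c : bounded_measurable (cst c).
Proof. by split; [exact: measurable_cst|exists `|c|]. Qed.

Lemma bounded_measurableD g h : bounded_measurable g -> bounded_measurable h ->
  bounded_measurable (fun x => g x + h x).
Proof.
move=> [mg [M gM]] [mh [N hN]]; split; first exact: measurable_funD.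
by exists (M + N) => x; rewrite (le_trans (ler_normD _ _))// lerD.
Qed.

Lemma bounded_measurableM g h : bounded_measurable g -> bounded_measurable h ->
  bounded_measurable (fun x => g x * h x).
Proof.
move=> [mg [M gM]] [mh [N hN]]; split; first exact: measurable_funM.
by exists (M * N) => x; rewrite normrM ler_pM.
Qed.

Lemma bounded_measurableZ c g : bounded_measurable g ->
  bounded_measurable (fun x => c * g x).
Proof. by move=> ?; apply: bounded_measurableM => //; exact: bounded_measurable_cst. Qed.

Lemma bounded_measurableB g h : bounded_measurable g -> bounded_measurable h ->
  bounded_measurable (fun x => g x - h x).
Proof.
move=> bg bh; under eq_fun do rewrite -mulN1r.
by apply: bounded_measurableD => //; exact: bounded_measurableZ.
Qed.

Lemma bounded_measurable_indic A : measurable A -> bounded_measurable (\1_A : T -> R).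
Proof.
move=> mA; split; first exact: measurable_indic.
by exists 1 => x; rewrite indicE; case: (_ \in _); rewrite ?normr0 ?normr1.
Qed.

Lemma bounded_measurable_sum (J : Type) (s : seq J) (F : J -> T -> R) :
  (forall j, bounded_measurable (F j)) ->
  bounded_measurable (fun x => \sum_(j <- s) F j x).
Proof.
move=> bF; elim: s => [|j s IH].
  by under eq_fun do rewrite big_nil; exact: bounded_measurable_cst.
by under eq_fun do rewrite big_cons; exact: bounded_measurableD.
Qed.

Lemma bounded_measurable_sqr g : bounded_measurable g ->
  bounded_measurable (fun x => g x ^+ 2).
Proof. by move=> bg; exact: bounded_measurableM. Qed.

Variable P : probability T R.

Lemma bounded_measurable_integrable A g : measurable A ->
  bounded_measurable g -> P.-integrable A (EFin \o g).
Proof.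
move=> mA [mg [M gM]]; apply: measurable_bounded_integrable => //.
- by rewrite (le_lt_trans (probability_le1 P mA))// ltry.
- exact: measurable_funTS.
- exists M; split; first exact: num_real.
  by move=> N MN x _ /=; exact: le_trans (gM x) (ltW MN).
Qed.

Lemma integral_bmD g h : bounded_measurable g -> bounded_measurable h ->
  \int[P]_x (g x + h x) = \int[P]_x g x + \int[P]_x h x.
Proof. by move=> ? ?; rewrite RintegralD//; exact: bounded_measurable_integrable. Qed.

Lemma integral_bmB g h : bounded_measurable g -> bounded_measurable h ->
  \int[P]_x (g x - h x) = \int[P]_x g x - \int[P]_x h x.
Proof. by move=> ? ?; rewrite RintegralB//; exact: bounded_measurable_integrable. Qed.

Lemma integral_bmZ c g : bounded_measurable g ->
  \int[P]_x (c * g x) = c * \int[P]_x g x.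
Proof. by move=> ?; rewrite RintegralZl//; exact: bounded_measurable_integrable. Qed.

Lemma integral_bm_sum (J : Type) (s : seq J) (F : J -> T -> R) :
  (forall j, bounded_measurable (F j)) ->
  \int[P]_x (\sum_(j <- s) F j x) = \sum_(j <- s) \int[P]_x F j x.
Proof.
move=> bF; elim: s => [|j s IH].
  rewrite big_nil; under eq_Rintegral do rewrite big_nil.
  by rewrite Rintegral_cst// mul0r.
rewrite big_cons; under eq_Rintegral do rewrite big_cons.
by rewrite integral_bmD// ?IH//; exact: bounded_measurable_sum.
Qed.

Lemma le_integral_bm g h : bounded_measurable g -> bounded_measurable h ->
  (forall x, g x <= h x) -> \int[P]_x g x <= \int[P]_x h x.
Proof. by move=> ? ? ?; apply: le_Rintegral => //; exact: bounded_measurable_integrable. Qed.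

Lemma integral_prob_cst c : \int[P]_x c = c.
Proof. by rewrite Rintegral_cst//= (@probability_setT _ T R P) mulr1. Qed.

Lemma norm_integral_bm g M : bounded_measurable g -> (forall x, `|g x| <= M) ->
  `|\int[P]_x g x| <= M.
Proof.
move=> bg gM; have gM' x : - M <= g x <= M by rewrite -ler_norml.
have bc c : bounded_measurable (cst c : T -> R) by exact: bounded_measurable_cst.
rewrite ler_norml -(integral_prob_cst (- M)) -[X in _ && (_ <= X)](integral_prob_cst M).
apply/andP; split; apply: (le_integral_bm (bc _) bg) || apply: (le_integral_bm bg (bc _)).
  by move=> x; have /andP[] := gM' x.
by move=> x; have /andP[] := gM' x.
Qed.

End bounded_measurable.

Ltac solve_bm := repeat first
  [ assumption
  | match goal with H : forall n, bounded_measurable _ |- _ => exact: H end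
  | exact: bounded_measurable_cst | apply: bounded_measurable_sqr
  | apply: bounded_measurableB | apply: bounded_measurableD
  | apply: bounded_measurableM ].

(** * Weak convergence of almost orthogonal sequences *)
Section weakly_null.
Context {R : realType} {dT : measure_display} {T : measurableType dT}.
Variable P : probability T R.
Context {J : Type} {F : set_system J} {FF : Filter F}.
Variable e : J -> T -> R.
Hypothesis e_measurable : forall n, measurable_fun setT (e n).
Hypothesis e_le1 : forall n x, `|e n x| <= 1.
Hypothesis e_almost_orthogonal :
  forall k, \int[P]_x (e k x * e n x) @[n --> F] --> (0 : R).

Let be n : bounded_measurable (e n). Proof. by split=> //; exists 1. Qed.

(** Let [V] be the space of bounded functions that become orthogonal to [e n],
    and let [g] in [V] almost minimize the squared [L^2] distance to [h], up to
    [(eps / 2) ^ 2].  With [beta = \int (h - g) e n], the function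
    [g + beta * e n] is again in [V] and its squared distance to [h] is smaller by
    at least [beta ^ 2]; so [`|beta| < eps / 2] for every [n], and
    [\int g * e n] tends to [0]. *)
Lemma almost_orthogonal_weakly_null (h : T -> R) : bounded_measurable h ->
  \int[P]_x (h x * e n x) @[n --> F] --> (0 : R).
Proof.
move=> bh.
pose V := [set g : T -> R | bounded_measurable g /\
  \int[P]_x (g x * e n x) @[n --> F] --> (0 : R)].
pose dist (g : T -> R) := \int[P]_x ((h x - g x) ^+ 2).
have distE : has_inf (dist @` V).
  split; last first.
    by exists 0 => _ [g _ <-]; apply: Rintegral_ge0 => x _; exact: sqr_ge0.
  exists (dist (cst 0)), (cst 0) => //; split; first exact: bounded_measurable_cst.
  under eq_fun do under eq_Rintegral do rewrite mul0r.
  by under eq_fun do rewrite integral_prob_cst; exact: cvg_cst.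
apply/cvgr0Pnorm_lt => eps eps0; have eps20 : 0 < eps / 2 by rewrite divr_gt0.
have [_ [g [bg gV] <-] gdist] := inf_adherent (exprn_gt0 2 eps20) distE.
have bhg : bounded_measurable (fun x => h x - g x) by exact: bounded_measurableB.
have beta_small n : `|\int[P]_x ((h x - g x) * e n x)| < eps / 2.
  set beta := \int[P]_x _.
  have Vg' : V (fun x => g x + beta * e n x).
    split; first by apply: bounded_measurableD => //; exact: bounded_measurableZ.
    have -> : (fun k => \int[P]_x ((g x + beta * e n x) * e k x)) =
        (fun k => \int[P]_x (g x * e k x) + beta * \int[P]_x (e n x * e k x)).
      apply/funext => k; rewrite -integral_bmZ; last exact: bounded_measurableM.
      rewrite -integral_bmD; [|exact: bounded_measurableM|]; last first.
        by apply: bounded_measurableZ; exact: bounded_measurableM.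
      by apply: eq_Rintegral => x _; rewrite mulrDl mulrA.
    rewrite -[X in _ --> X](addr0 0) -[X in _ --> 0 + X](mulr0 beta).
    exact: cvgD gV (cvgM (cvg_cst beta) (@e_almost_orthogonal n)).
  have inf_le : inf (dist @` V) <= dist (fun x => g x + beta * e n x).
    by apply: ge_inf; [exact: distE.2|exists (fun x => g x + beta * e n x)].
  have dist_le : dist (fun x => g x + beta * e n x) <= dist g - beta ^+ 2.
    rewrite /dist.
    have -> : \int[P]_x ((h x - g x) ^+ 2) - beta ^+ 2 =
       \int[P]_x ((h x - g x) ^+ 2 + (- (2 * beta) * ((h x - g x) * e n x) + beta ^+ 2)).
      rewrite integral_bmD; [|by solve_bm|by solve_bm].
      rewrite integral_bmD; [|by solve_bm|by solve_bm].
      rewrite integral_bmZ; last by solve_bm.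
      by rewrite integral_prob_cst -/beta; field.
    apply: le_integral_bm => [||x]; [by solve_bm|by solve_bm|].
    have e2 : e n x ^+ 2 <= 1 by rewrite -real_normK ?num_real// expr_le1.
      have := ler_wpM2l (sqr_ge0 beta) e2; nra.
  rewrite -(@ltr_pXn2r _ 2)// ?nnegrE ?ltW// real_normK ?num_real//.
  by move: gdist; rewrite -/(dist g); lra.
move/cvgr0Pnorm_lt : gV => /(_ _ eps20).
apply: filterS => n gn.
have -> : \int[P]_x (h x * e n x) =
    \int[P]_x ((h x - g x) * e n x) + \int[P]_x (g x * e n x).
  rewrite -integral_bmD; [|exact: bounded_measurableM|exact: bounded_measurableM].
  by apply: eq_Rintegral => x _; rewrite -mulrDl subrK.
by rewrite (le_lt_trans (ler_normD _ _))// (splitr eps) ltrD.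
Qed.

End weakly_null.

(** * Sets of integers of density one *)

#[global] Instance to_infty_in_filter (E : set int) : Filter (to_infty_in E).
Proof.
apply: filter_from_filter; first by exists 0%N.
move=> i j _ _; exists (maxn i j) => // n [nE]; rewrite geq_max => /andP[in_ jn].
by split.
Qed.

Section density.
Context {R : realType}.
Implicit Types a C : int -> R.

Definition centered_mean a N : R :=
  (\sum_(k < N.*2.+1) a (k%:Z - N%:Z)) / N.*2.+1%:R.

Lemma le_centered_mean a b N : (forall n, a n <= b n) ->
  centered_mean a N <= centered_mean b N.
Proof. by move=> ab; rewrite ler_pM2r ?invr_gt0 ?ltr0n//; apply: ler_sum. Qed.

Lemma centered_mean_cst c N : centered_mean (cst c) N = c.
Proof.
by rewrite /centered_mean sumr_const card_ord -[c *+ _]mulr_natr mulfK// pnatr_eq0.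
Qed.

Lemma centered_meanD a b N :
  centered_mean (fun n => a n + b n) N = centered_mean a N + centered_mean b N.
Proof. by rewrite /centered_mean big_split mulrDl. Qed.

Lemma centered_mean_sum (J : Type) (s : seq J) (a : J -> int -> R) N :
  centered_mean (fun n => \sum_(j <- s) a j n) N = \sum_(j <- s) centered_mean (a j) N.
Proof. by rewrite /centered_mean exchange_big mulr_suml. Qed.

Lemma centered_mean_ge0 a N : (forall n, 0 <= a n) -> 0 <= centered_mean a N.
Proof. by move=> a0; rewrite -(centered_mean_cst 0 N); exact: le_centered_mean. Qed.

(** The threshold for [C n] is [sqrt (delta `|n|)], where [delta] dominates the
    later Cesaro means and decreases to [0]; the term [1 / (N + 1)] only keeps it
    positive.  Each exceptional integer in [[-N, N]] contributes at least
    [sqrt (delta N)] to a sum bounded by [(2 N + 1) delta N], so the exceptional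
    proportion is at most [sqrt (delta N)]. *)
Lemma koopman_von_neumann C : (forall n, 0 <= C n <= 1) ->
  centered_mean C N @[N --> \oo] --> (0 : R) ->
  exists E : set int, full_density R E /\ C n @[n --> to_infty_in E] --> (0 : R).
Proof.
move=> C01 mC0.
have C0 n : 0 <= C n by have /andP[] := C01 n.
pose tail N := [set centered_mean C M | M in [set M | (N <= M)%N]].
have tail_sup N : has_sup (tail N).
  split; first by exists (centered_mean C N), N => /=.
  exists 1 => _ [M _ <-]; rewrite -(centered_mean_cst 1 M).
  by apply: le_centered_mean => n; have /andP[] := C01 n.
pose delta N := sup (tail N) + N.+1%:R^-1.
have mean_delta N : centered_mean C N <= delta N.
  rewrite -[leLHS]addr0 lerD// ?invr_ge0//; apply: sup_upper_bound => //.
  by exists N => /=.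
have delta_gt0 N : 0 < delta N.
  rewrite ltr_wpDl ?invr_gt0 ?ltr0n//.
  apply: le_trans (centered_mean_ge0 N C0) _; apply: sup_upper_bound => //.
  by exists N => /=.
have delta_decr M N : (M <= N)%N -> delta N <= delta M.
  move=> MN; apply: lerD; last by rewrite lef_pV2 ?posrE ?ltr0n// ler_nat.
  apply: ge_sup; first exact: (tail_sup N).1.
  move=> _ [k Nk <-]; apply: sup_upper_bound => //.
  by exists k => //=; exact: leq_trans MN Nk.
have delta_cvg0 : delta N @[N --> \oo] --> (0 : R).
  rewrite -(addr0 0); apply: cvgD; last exact: cvg_harmonic.
  apply/cvgr0Pnorm_le => e e0; move/cvgr0Pnorm_le : mC0 => /(_ _ e0)[N _ NP].
  near=> k; have Nk : (N <= k)%N by near: k; exists N.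
  rewrite ger0_norm.
    apply: ge_sup; first exact: (tail_sup k).1.
    move=> _ [M kM <-]; apply: le_trans (ler_norm _) _; apply: NP => /=.
    exact: leq_trans Nk kM.
  apply: le_trans (centered_mean_ge0 k C0) _; apply: sup_upper_bound => //.
  by exists k => /=.
pose sqd N := Num.sqrt (delta N).
have sqd_gt0 N : 0 < sqd N by rewrite sqrtr_gt0.
have sqd_cvg0 : sqd N @[N --> \oo] --> (0 : R).
  rewrite -sqrtr0; apply: (continuous_cvg _ _ delta_cvg0); exact: sqrt_continuous.
exists [set n | C n < sqd `|n|%N]; split.
  pose E := [set n | C n < sqd `|n|%N].
  pose count N := #|[pred k : 'I_(N.*2.+1) | (k%:Z - N%:Z) \in E]|.
  have lower N : 1 - sqd N <= (count N)%:R / N.*2.+1%:R.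
    rewrite lerBlDl -lerBlDr.
    have sqd2 : sqd N * sqd N = delta N by rewrite -expr2 sqr_sqrtr// ltW.
    rewrite -(ler_pM2r (sqd_gt0 N)) sqd2; apply: le_trans _ (mean_delta N).
    rewrite ler_pdivlMr ?ltr0n// mulrAC mulrBl mul1r divfK ?pnatr_eq0// mulrC.
    have -> : N.*2.+1%:R - (count N)%:R =
        (#|[pred k : 'I_(N.*2.+1) | (k%:Z - N%:Z) \notin E]|)%:R :> R.
      apply/eqP; rewrite subr_eq -natrD eqr_nat; apply/eqP.
      rewrite -[LHS]card_ord -(cardC [pred k : 'I_(N.*2.+1) | (k%:Z - N%:Z) \in E]).
      by rewrite addnC; congr (_ + _)%N; apply: eq_card => k; rewrite !inE.
    rewrite -sum1_card natr_sum mulr_sumr [leLHS]big_mkcond; apply: ler_sum => k _.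
    rewrite inE; case: ifPn => // /negP kE; rewrite mulr1 leNgt; apply/negP => Ck.
    apply: kE; rewrite inE /E /=; apply: lt_le_trans Ck _.
    by rewrite ler_wsqrtr//; apply: delta_decr; have := ltn_ord k; lia.
  have upper N : (count N)%:R / N.*2.+1%:R <= 1 :> R.
    rewrite ler_pdivrMr ?ltr0n// mul1r ler_nat -[leqRHS]card_ord; exact: max_card.
  apply: (@squeeze_cvgr _ _ _ _ (fun N => 1 - sqd N) (cst 1)).
  - by near=> N; rewrite lower upper.
  - by rewrite -[X in _ --> X](subr0 1); apply: cvgB => //; exact: cvg_cst.
  - exact: cvg_cst.
apply/cvgr0Pnorm_lt => e e0; move/cvgr0Pnorm_lt : sqd_cvg0 => /(_ _ e0)[N _ NP].
exists N => // n [/set_mem/= nE Nn]; rewrite ger0_norm//.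
by apply: lt_le_trans nE _; apply: le_trans (ler_norm _) _; apply/ltW/NP.
Unshelve. all: by end_near. Qed.

(** The sequence [C n = max_(j < `|n|) a j n / (j + 1)] controls each [a j] for
    large [n], and for each [J] it is at most
    [\sum_(j < J) a j n + 1 / (J + 1)], so its Cesaro means tend to [0]. *)
Lemma koopman_von_neumann_family (a : nat -> int -> R) :
  (forall j n, 0 <= a j n <= 1) ->
  (forall j, centered_mean (a j) N @[N --> \oo] --> (0 : R)) ->
  exists E : set int, full_density R E /\
    forall j, a j n @[n --> to_infty_in E] --> (0 : R).
Proof.
move=> a01 ma0.
have a0 j n : 0 <= a j n by have /andP[] := a01 j n.
have a1 j n : a j n <= 1 by have /andP[] := a01 j n.
pose C n := \big[Num.max/0]_(j < `|n|%N) (a j n / j.+1%:R).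
have C_ge0 n : 0 <= C n by rewrite /C; exact: bigmax_ge_id.
have C_le J n : C n <= \sum_(j < J) a j n + J.+1%:R^-1.
  apply: bigmax_le => [|j _]; first by rewrite addr_ge0 ?invr_ge0// sumr_ge0.
  have [jJ|Jj] := ltnP j J.
    rewrite -[leLHS]addr0 lerD ?invr_ge0//.
    apply: (@le_trans _ _ (a j n)).
      by rewrite ler_pdivrMr ?ltr0n// ler_peMr// ler1n.
    by rewrite (bigD1 (Ordinal jJ))//= lerDl sumr_ge0.
  rewrite -[leLHS]add0r lerD// ?sumr_ge0//.
  rewrite -[leRHS]mul1r ler_pM// ?invr_ge0// lef_pV2 ?posrE ?ltr0n//.
  by rewrite ler_nat.
have [n||E [dE CE]] := @koopman_von_neumann C.
- by rewrite C_ge0/= (le_trans (C_le 0 n))// big_ord0 add0r invr1.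
- apply/cvgr0Pnorm_le => e e0.
  have [J J_large] : exists J : nat, J.+1%:R^-1 < e / 2.
    have [J] := ltr_add_invr (divr_gt0 e0 (ltr0n R 2)); rewrite add0r; by exists J.
  have : \sum_(j < J) centered_mean (a j) N @[N --> \oo] --> (0 : R).
    elim: J {J_large} => [|J IH].
      by under eq_fun do rewrite big_ord0; exact: cvg_cst.
    have -> : (fun N => \sum_(j < J.+1) centered_mean (a j) N) =
        (fun N => \sum_(j < J) centered_mean (a j) N + centered_mean (a J) N).
      by apply/funext => N; rewrite big_ord_recr.
    have := cvgD IH (ma0 J); rewrite addr0 => h; exact: h.
  have e20 : 0 < e / 2 by rewrite divr_gt0.
  move=> /cvgr0Pnorm_le/(_ _ e20); apply: filterS => N.
  rewrite !ger0_norm ?centered_mean_ge0// => [sN|]; last first.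
    by apply: sumr_ge0 => j _; exact: centered_mean_ge0.
  apply: le_trans (le_centered_mean N (C_le J)) _.
  rewrite centered_meanD (centered_mean_cst (J.+1%:R^-1)) centered_mean_sum.
  by rewrite (splitr e) lerD// ltW.
exists E; split=> // j.
apply/cvgr0Pnorm_lt => e e0.
have ej0 : 0 < e / j.+1%:R by rewrite divr_gt0.
move/cvgr0Pnorm_lt : CE => /(_ _ ej0)[N _ NP].
exists (maxn N j.+1) => // n [nE]; rewrite geq_max => /andP[Nn jn].
have := NP n (conj nE Nn); rewrite /= !ger0_norm//; apply: contraTT.
rewrite -!leNgt => ean; rewrite /C; apply: le_trans (le_bigmax _ _ (Ordinal jn)).
by rewrite ler_pM2r.
Qed.

End density.

(** * Wiener's lemma *)

Section dirichlet.
Context {R : realType}.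

Lemma centered_mean_norm_le (a : int -> R) N M : (forall n, `|a n| <= M) ->
  `|centered_mean a N| <= M.
Proof.
move=> aM; rewrite /centered_mean normrM normfV normr_nat ler_pdivrMr ?ltr0n//.
apply: le_trans (ler_norm_sum _ _ _) _; rewrite mulr_natr -[N.*2.+1 in leRHS]card_ord.
by rewrite -sumr_const; apply: ler_sum.
Qed.

(** Multiplied by [2 sin (pi r)], where [r] represents [t], the sum telescopes to
    a difference of two sines. *)
Lemma dirichlet_cvg0 (t : circle R) (k : int) : t <> 0 ->
  centered_mean (fun n => circle_cos (t *~ (n + k))) N @[N --> \oo] --> (0 : R).
Proof.
elim/(@circle_ind R): t => r r_nint; set S := sin (pi * r).
have S0 : S != 0.
  apply/eqP => S0; apply: r_nint; apply: circle_cos_eq1.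
  by rewrite circle_cosE mulrnAl cos_mulr2n cos2sin2 -/S S0 expr0n subr0; lra.
pose s (m : R) := sin (pi *+ 2 * r * m - pi * r).
have telescope N (c : int) : 2 * S * (\sum_(j < N) circle_cos (\pi_(circle R)%qT r *~ (j%:Z + c))) =
    s (N%:Z + c)%:~R - s c%:~R.
  elim: N => [|N IH]; first by rewrite big_ord0 mulr0 add0r subrr.
  rewrite big_ord_recr/= mulrDr IH -pi_circle_mulz circle_cosE -[r *~ _]mulrzr.
  have -> : s (N.+1%:Z + c)%:~R = sin (pi *+ 2 * r * (N%:Z + c)%:~R + pi * r).
    have -> : (N.+1%:Z + c)%:~R = (N%:Z + c)%:~R + 1 :> R.
      by rewrite -intrD1; congr (_%:~R); lia.
    by rewrite /s; congr sin; rewrite mulrDr mulr1 -addrA mulrnAl mulr2n addrK.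
  rewrite /s [pi *+ 2 * (r * _)]mulrA; set A := pi *+ 2 * r * (N%:Z + c)%:~R.
  by rewrite [sin (A - _)]sinB [sin (A + _)]sinD -/S; move: (sin (_ - _)) => z; lra.
have bound N : `|centered_mean (fun n => circle_cos (\pi_(circle R)%qT r *~ (n + k))) N| <=
    `|S|^-1 * N.+1%:R^-1.
  rewrite /centered_mean normrM normfV normr_nat ler_pM ?invr_ge0//; last first.
    by rewrite lef_pV2 ?posrE ?ltr0n// ler_nat; lia.
  under eq_bigr do rewrite -addrA.
  rewrite -(ler_pM2l (_ : 0 < 2 * `|S|)) ?mulr_gt0 ?normr_gt0//.
  rewrite mulfK ?normr_eq0//.
  rewrite -{1}(ger0_norm (ler0n R 2)) -!normrM telescope.
  rewrite (le_trans (ler_normB _ _))// (_ : 2 = 1 + 1)// lerD//; exact: sin_max.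
have cvg0 : `|S|^-1 * N.+1%:R^-1 @[N --> \oo] --> (0 : R).
  have h := cvgM (cvg_cst `|S|^-1) (@cvg_harmonic R).
  by rewrite mulr0 in h; exact: h.
apply: (@squeeze_cvgr _ _ _ _ (fun N => - (`|S|^-1 * N.+1%:R^-1))
    (fun N => `|S|^-1 * N.+1%:R^-1)) => //.
- by apply: nearW => N; rewrite -ler_norml; exact: bound.
- by have h := cvgN cvg0; rewrite oppr0 in h; exact: h.
Qed.

End dirichlet.

Section wiener.
Context {R : realType} {dT : measure_display} {T : measurableType dT}.
Variable P : probability T R.

Lemma bounded_cvg0_integral (g : nat -> T -> R) :
  (forall n, measurable_fun setT (g n)) -> (forall n x, `|g n x| <= 1) ->
  {ae P, forall x, g n x @[n --> \oo] --> (0 : R)} ->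
  \int[P]_x g n x @[n --> \oo] --> (0 : R).
Proof.
move=> mg g1 g0.
have [] := @dominated_convergence _ T R P setT measurableT
   (fun n x => (g n x)%:E) (cst 0%E) (cst 1%E).
- by move=> n; apply/measurable_EFinP.
- exact: measurable_cst.
- apply: filterS g0 => x gx _.
  by apply: cvg_EFin; [exact: nearW|exact: gx].
- apply: (bounded_measurable_integrable P measurableT (bounded_measurable_cst 1)).
- by apply: aeW => x n _; rewrite lee_fin.
move=> _ _; rewrite integral0 => h.
have := fine_cvg h; exact.
Qed.

Variable theta : T -> circle R.
Hypothesis cos_measurable :
  forall n : int, measurable_fun setT (fun x => circle_cos (theta x *~ n)).
Hypothesis sin_measurable :
  forall n : int, measurable_fun setT (fun x => circle_sin (theta x *~ n)).
Hypothesis theta_atomless : forall c, P [set x | theta x = c] = 0%E.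

Definition cos_coef (n : int) : R := \int[P]_x circle_cos (theta x *~ n).

Let bc n : bounded_measurable (fun x => circle_cos (theta x *~ n)).
Proof. by split=> //; exists 1 => x; exact: circle_cos_max. Qed.

Let fiber_measurable c : measurable [set x | theta x = c].
Proof.
pose u x := circle_cos (theta x *~ 1) * circle_cos c +
            circle_sin (theta x *~ 1) * circle_sin c.
have mu : measurable_fun setT u.
  by apply: measurable_funD; apply: measurable_funM => //; exact: measurable_cst.
have -> : [set x | theta x = c] = setT `&` u @^-1` [set 1].
  rewrite setTI; apply/seteqP; split=> x /=.
    by move=> xc; rewrite /u mulr1z xc -!expr2 circle_cos2Dsin2.
  rewrite /u mulr1z => u1; apply/subr0_eq/circle_cos_eq1.
  by rewrite circle_cosD circle_cosN circle_sinN mulrN opprK.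
exact: mu.
Qed.

Lemma integral_centered_mean (a : int -> T -> R) N :
  (forall n, bounded_measurable (a n)) ->
  \int[P]_x centered_mean (a^~ x) N = centered_mean (fun n => \int[P]_x a n x) N.
Proof.
move=> ba; rewrite /centered_mean mulrC -integral_bm_sum// -integral_bmZ.
  by apply: eq_Rintegral => x _; rewrite mulrC.
exact: bounded_measurable_sum.
Qed.

Lemma bounded_measurable_centered_mean (a : int -> T -> R) N :
  (forall n, bounded_measurable (a n)) ->
  bounded_measurable (fun x => centered_mean (a^~ x) N).
Proof.
move=> ba; apply: bounded_measurableM; last exact: bounded_measurable_cst.
exact: bounded_measurable_sum.
Qed.

(** The mean of [cos_coef (n + k) ^ 2] is the double integral of the mean [D] of
    [cos ((n + k) theta x) cos ((n + k) theta y)].  For fixed [x], [D] tends to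
    [0] unless [theta y] is [theta x] or [- theta x], that is for almost all [y];
    bounded convergence in [y] and then in [x] concludes. *)
Lemma wiener (k : int) :
  centered_mean (fun n => cos_coef (n + k) ^+ 2) N @[N --> \oo] --> (0 : R).
Proof.
pose D N x y := centered_mean (fun n =>
  circle_cos (theta x *~ (n + k)) * circle_cos (theta y *~ (n + k))) N.
have D_le1 N x y : `|D N x y| <= 1.
  apply: centered_mean_norm_le => n; rewrite normrM mulr_ile1//; exact: circle_cos_max.
have bD N x : bounded_measurable (D N x).
  by apply: bounded_measurable_centered_mean => n; exact: bounded_measurableZ.
have DE N x y : D N x y = 2^-1 *
    (centered_mean (fun n => circle_cos ((theta x + theta y) *~ (n + k))) N +
     centered_mean (fun n => circle_cos ((theta x - theta y) *~ (n + k))) N).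
  rewrite -centered_meanD /D /centered_mean mulrA mulr_sumr; congr (_ / _).
  apply: eq_bigr => n _; rewrite !mulrzDl mulNrz !circle_cosD circle_cosN circle_sinN.
  by field.
have D_cvg0 x : \int[P]_y D N x y @[N --> \oo] --> (0 : R).
  apply: bounded_cvg0_integral => [N|//|]; first by have [] := bD N x.
  exists ([set y | theta y = - theta x] `|` [set y | theta y = theta x]); split.
  - exact: measurableU.
  - exact: null_set_setU (fiber_measurable _) (fiber_measurable _)
      (theta_atomless _) (theta_atomless _).
  - move=> y /= ncvg; apply: contrapT => /not_orP[yx1 yx2]; apply: ncvg.
    under eq_fun do rewrite DE.
    rewrite -(mulr0 2^-1) -[X in _ * X](addr0 0).
    apply: cvgM; first exact: cvg_cst.
    apply: cvgD; apply: dirichlet_cvg0.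
      by move=> /eqP; rewrite addrC addr_eq0 => /eqP.
    by move=> /subr0_eq /esym.
have DintE N : (fun x => \int[P]_y D N x y) = (fun x =>
    centered_mean (fun n => cos_coef (n + k) * circle_cos (theta x *~ (n + k))) N).
  apply/funext => x; rewrite integral_centered_mean => [|n]; last exact: bounded_measurableZ.
  by congr (centered_mean _ N); apply/funext => n; rewrite integral_bmZ// mulrC.
have -> : (fun N => centered_mean (fun n => cos_coef (n + k) ^+ 2) N) =
    (fun N => \int[P]_x (\int[P]_y D N x y)).
  apply/funext => N; rewrite DintE.
  rewrite integral_centered_mean => [|n]; last exact: bounded_measurableZ.
  by congr (centered_mean _ N); apply/funext => n; rewrite integral_bmZ// expr2.
apply: bounded_cvg0_integral => [N|N x|].
- rewrite DintE.
  have [] // := @bounded_measurable_centered_mean (fun n x =>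
    cos_coef (n + k) * circle_cos (theta x *~ (n + k))) N _.
  by move=> n; exact: bounded_measurableZ.
- exact: norm_integral_bm.
- by apply: aeW => x; exact: D_cvg0.
Qed.

End wiener.

(** * Integration along a disintegration *)

Section bounded_induction.
Context {R : realType} {dT : measure_display} {T : measurableType dT}.

(** The sum rounds [u] down to a multiple of [e]. *)
Lemma layer_cake_step (e u : R) k : 0 < e -> 0 <= u <= e * k%:R ->
  `|u - \sum_(j < k) e * (e * j.+1%:R <= u)%R%:R| <= e.
Proof.
move=> e0; elim: k => [|k IH] /andP[u0 uk].
  have -> : u = 0 by apply/le_anti; rewrite u0 (le_trans uk)// mulr0.
  by rewrite big_ord0 subrr normr0 ltW.
rewrite big_ord_recr/=; have [uek|eku] := leP u (e * k%:R).
  rewrite [e * k.+1%:R <= u]leNgt (le_lt_trans uek) ?ltr_pM2l ?ltr_nat//= mulr0 addr0.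
  by apply: IH; rewrite u0.
rewrite (eq_bigr (fun=> e)) => [|j _]; last first.
  by rewrite (le_trans _ (ltW eku)) ?mulr1// ler_pM2l// ler_nat.
rewrite sumr_const card_ord -[e *+ k]mulr_natr.
move: uk eku; rewrite -natr1 mulrDr mulr1; set v := e * k%:R => uk eku.
by case: (_ <= u); rewrite ?mulr1 ?mulr0 ler_norml; lra.
Qed.

(** Every bounded measurable function is a uniform limit of layer-cake sums
    [\sum_(j < k) e * 1_{g + M >= e (j + 1)} - M]. *)
Lemma bounded_measurable_ind (Q : (T -> R) -> Prop) :
  (forall B, measurable B -> Q \1_B) ->
  (forall c g, bounded_measurable g -> Q g -> Q (fun x => c * g x)) ->
  (forall g h, bounded_measurable g -> bounded_measurable h ->
    Q g -> Q h -> Q (fun x => g x + h x)) ->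
  (forall g, bounded_measurable g -> (forall e, 0 < e ->
    exists2 h, bounded_measurable h /\ Q h & forall x, `|g x - h x| <= e) -> Q g) ->
  forall g, bounded_measurable g -> Q g.
Proof.
move=> Q1 QZ QD Qlim g bg; apply: Qlim => // e e0; have [mg [M gM]] := bg.
have cstQ c : bounded_measurable (cst c : T -> R) /\ Q (cst c).
  split; first exact: bounded_measurable_cst.
  have -> : cst c = (fun x => c * (\1_setT : T -> R) x).
    by apply/funext => x; rewrite indicT mulr1.
  by apply: QZ; [exact: bounded_measurable_indic|exact: Q1].
pose B j := [set x | e * j.+1%:R <= g x + M].
have mB j : measurable (B j).
  have -> : B j = setT `&` (fun x => g x + M) @^-1` `[e * j.+1%:R, +oo[.
    by rewrite setTI; apply/seteqP; split => x /=; rewrite in_itv/= andbT.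
  by apply: measurable_funD => //; exact: measurable_cst.
have sumQ k : bounded_measurable (fun x => \sum_(j < k) e * (\1_(B j) : T -> R) x) /\
    Q (fun x => \sum_(j < k) e * (\1_(B j) : T -> R) x).
  have bB j : bounded_measurable (fun x => e * (\1_(B j) : T -> R) x).
    exact/bounded_measurableZ/bounded_measurable_indic.
  split; first exact: bounded_measurable_sum.
  elim: k => [|k IH].
    have -> : (fun x => \sum_(j < 0) e * (\1_(B j) : T -> R) x) = cst 0.
      by apply/funext => x; rewrite big_ord0.
    by have [] := cstQ 0.
  have -> : (fun x => \sum_(j < k.+1) e * (\1_(B j) : T -> R) x) =
      (fun x => \sum_(j < k) e * (\1_(B j) : T -> R) x + e * (\1_(B k) : T -> R) x).
    by apply/funext => x; rewrite big_ord_recr.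
  apply: QD => //; first exact: bounded_measurable_sum.
  by apply: QZ; [exact: bounded_measurable_indic|exact: Q1].
pose k := (Num.truncn (2 * M / e)).+1.
have kM : 2 * M <= e * k%:R.
  by rewrite [leRHS]mulrC -ler_pdivrMr//; apply/ltW; exact: truncnS_gt.
exists (fun x => \sum_(j < k) e * (\1_(B j) : T -> R) x + - M).
  by split; [apply: bounded_measurableD|apply: QD]; have [] := sumQ k; have [] := cstQ (- M).
move=> x; have := gM x; rewrite ler_norml => /andP[Mg gM'].
have -> : \sum_(j < k) e * (\1_(B j) : T -> R) x =
    \sum_(j < k) e * (e * j.+1%:R <= g x + M)%R%:R.
  apply: eq_bigr => j _; rewrite indicE; congr (_ * _%:R); congr nat_of_bool.
  by apply/idP/idP; rewrite inE.
rewrite opprD opprK addrA addrAC; apply: layer_cake_step => //.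
by apply/andP; split; lra.
Qed.

End bounded_induction.

Section integral_lemmas.
Context {R : realType} {dT : measure_display} {T : measurableType dT}.

Lemma bounded_measurable_comp {dU : measure_display} {U : measurableType dU}
    (g : T -> R) (phi : U -> T) :
  measurable_fun setT phi -> bounded_measurable g ->
  bounded_measurable (fun u => g (phi u)).
Proof.
move=> mphi [mg [M gM]]; split; last by exists M.
exact: measurableT_comp.
Qed.

Lemma integral_bm_indic (P : probability T R) B : measurable B ->
  \int[P]_x (\1_B : T -> R) x = fine (P B).
Proof. by move=> mB; rewrite /Rintegral integral_indic// setIT. Qed.

Lemma integral_bm_dist (P : probability T R) (g h : T -> R) e :
  bounded_measurable g -> bounded_measurable h -> (forall x, `|g x - h x| <= e) ->
  `|\int[P]_x g x - \int[P]_x h x| <= e.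
Proof.
move=> bg bh ghe; rewrite -integral_bmB//; apply: norm_integral_bm => //.
exact: bounded_measurableB.
Qed.

End integral_lemmas.

Section disintegration.
Context {R : realType} {dI dK : measure_display}.
Context {I : measurableType dI} {K : measurableType dK}.

(** [k x] with its structure of probability measure. *)
Definition kernel_prob (k : R.-pker I ~> K) (x : I) : set K -> \bar R := k x.

HB.instance Definition _ (k : R.-pker I ~> K) (x : I) :=
  Measure.copy (kernel_prob k x) (k x).

HB.instance Definition _ (k : R.-pker I ~> K) (x : I) :=
  Measure_isProbability.Build _ _ _ (kernel_prob k x) (prob_kernel x).

Variable k : R.-pker I ~> K.

Definition kernel_integral (t : K -> R) (x : I) : R := \int[kernel_prob k x]_y t y.

Lemma kernel_integral_measurable t : bounded_measurable t ->
  bounded_measurable (kernel_integral t).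
Proof.
move=> bt; split; last first.
  by have [_ [M tM]] := bt; exists M => x; apply: norm_integral_bm.
move: t bt; apply: bounded_measurable_ind => [B mB|c g bg mg|g h bg bh mg mh|g bg gP].
- have -> : kernel_integral \1_B = (fun x => fine (k x B)).
    by apply/funext => x; rewrite /kernel_integral integral_bm_indic.
  by apply: measurableT_comp => //; exact: measurable_kernel.
- have -> : kernel_integral (fun y => c * g y) = (fun x => c * kernel_integral g x).
    by apply/funext => x; exact: integral_bmZ.
  by apply: measurable_funM => //; exact: measurable_cst.
- have -> : kernel_integral (fun y => g y + h y) =
      (fun x => kernel_integral g x + kernel_integral h x).
    by apply/funext => x; exact: integral_bmD.
  exact: measurable_funD.
- have /choice[h hP] n : exists h, (bounded_measurable h /\
      measurable_fun setT (kernel_integral h)) /\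
      forall y, `|g y - h y| <= n.+1%:R^-1.
    have n0 : 0 < n.+1%:R^-1 :> R by rewrite invr_gt0 ltr0n.
    by have [h ? ?] := gP _ n0; exists h.
  apply: (@measurable_fun_cvg _ _ _ setT (fun n => kernel_integral (h n))).
    by move=> n; have [[]] := hP n.
  move=> x _; apply/cvgrPdist_le => e e0.
  have := @cvg_harmonic R; move=> /cvgr0Pnorm_le/(_ _ e0).
  apply: filterS => n; rewrite /= ger0_norm ?invr_ge0//; apply: le_trans.
  by have [[bh _] ?] := hP n; exact: integral_bm_dist.
Qed.

Variables (L : probability I R) (rho : probability (I * K)%type R).
Hypothesis k_disintegrates : forall A B, measurable A -> measurable B ->
  rho (A `*` B) = (\int[L]_(x in A) k x B)%E.

(** Both sides are linear and uniformly continuous in [t]; for indicators the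
    identity is the definition of a disintegration. *)
Lemma disintegration_integral A t : measurable A -> bounded_measurable t ->
  \int[rho]_z ((\1_A : I -> R) z.1 * t z.2) =
  \int[L]_x ((\1_A : I -> R) x * kernel_integral t x).
Proof.
move=> mA; have b1A := bounded_measurable_indic (R := R) mA.
have bl u : bounded_measurable u ->
    bounded_measurable (fun z : I * K => (\1_A : I -> R) z.1 * u z.2).
  move=> bu; apply: bounded_measurableM.
    exact: (bounded_measurable_comp measurable_fst).
  exact: (bounded_measurable_comp measurable_snd).
have br u : bounded_measurable u ->
    bounded_measurable (fun x => (\1_A : I -> R) x * kernel_integral u x).
  by move=> bu; apply: bounded_measurableM => //; exact: kernel_integral_measurable.
move: t; apply: bounded_measurable_ind => [B mB|c g bg IH|g h bg bh IHg IHh|g bg gP].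
- have -> : (fun z : I * K => (\1_A : I -> R) z.1 * (\1_B : K -> R) z.2) = \1_(A `*` B).
    by apply/funext => -[x y]; rewrite !indicE -natrM mulnb in_setX.
  rewrite integral_bm_indic; last exact: measurableX.
  rewrite k_disintegrates// integral_mkcond /Rintegral; congr fine.
  apply: eq_integral => x _; rewrite /kernel_integral integral_bm_indic//=.
  rewrite patchE indicE; case: ifPn => _; rewrite ?mul0r// mul1r fineK//.
  by rewrite (@fin_num_measure _ _ _ (kernel_prob k x)).
- transitivity (\int[rho]_z (c * ((\1_A : I -> R) z.1 * g z.2))).
    by apply: eq_Rintegral => z _; rewrite mulrCA.
  rewrite integral_bmZ ?IH//; last exact: bl.
  rewrite -integral_bmZ; last exact: br.
  by apply: eq_Rintegral => x _; rewrite {2}/kernel_integral integral_bmZ// mulrCA.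
- transitivity (\int[rho]_z ((\1_A : I -> R) z.1 * g z.2 + (\1_A : I -> R) z.1 * h z.2)).
    by apply: eq_Rintegral => z _; rewrite mulrDr.
  rewrite integral_bmD ?IHg ?IHh; [|exact: bl|exact: bl].
  rewrite -integral_bmD; [|exact: br|exact: br].
  by apply: eq_Rintegral => x _; rewrite {3}/kernel_integral integral_bmD// mulrDr.
- apply/eqP; rewrite -subr_eq0 -normr_le0; apply/ler_addgt0Pl => e e0.
  rewrite addr0; have e20 : 0 < e / 2 by rewrite divr_gt0.
  have [h [bh IHh] gh] := gP _ e20.
  have cut (u v : R) (x : I) : `|u - v| <= e / 2 ->
      `|(\1_A : I -> R) x * u - (\1_A : I -> R) x * v| <= e / 2.
    rewrite -mulrBr normrM indicE; case: (_ \in _); rewrite ?normr1 ?mul1r// normr0 mul0r.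
    by move=> _; exact: ltW.
  have hl := @integral_bm_dist _ _ _ rho _ _ (e / 2) (bl _ bg) (bl _ bh)
    (fun z => cut _ _ z.1 (gh z.2)).
  have hr := @integral_bm_dist _ _ _ L _ _ (e / 2) (br _ bg) (br _ bh)
    (fun x => cut _ _ x (integral_bm_dist (kernel_prob k x) bg bh gh)).
  move: hl hr; rewrite IHh; set a := \int[rho]_z _; set b := \int[L]_x _; set c := \int[L]_x _.
  by rewrite !ler_norml; lra.
Qed.

End disintegration.

(** * Comparison of integrals *)

Section EFin_integral.
Context {R : realType} {dT : measure_display} {T : measurableType dT}.

Lemma EFin_integral_bm (P : probability T R) A (g : T -> R) :
  measurable A -> bounded_measurable g ->
  (\int[P]_(x in A) (g x)%:E)%E = (\int[P]_(x in A) g x)%:E.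
Proof.
move=> mA bg; rewrite /Rintegral fineK//.
by apply: integrable_fin_num => //; exact: bounded_measurable_integrable.
Qed.

End EFin_integral.

Section integral_transfer.
Context {R : realType} {d1 d2 d3 : measure_display}.
Context {T : measurableType d1} {U : measurableType d2} {V : measurableType d3}.

Lemma integral_same_law (P : probability T R) (Q : probability U R)
    (a : T -> V) (b : U -> V) (g : V -> R) :
  measurable_fun setT a -> measurable_fun setT b ->
  (forall B, measurable B -> P (a @^-1` B) = Q (b @^-1` B)) ->
  bounded_measurable g -> \int[P]_x g (a x) = \int[Q]_y g (b y).
Proof.
move=> ma mb abP.
have ba h : bounded_measurable h -> bounded_measurable (fun x => h (a x) : R).
  exact: bounded_measurable_comp.
have bb h : bounded_measurable h -> bounded_measurable (fun x => h (b x) : R).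
  exact: bounded_measurable_comp.
move: g; apply: bounded_measurable_ind => [B mB|c g bg IH|g h bg bh IHg IHh|g bg gP].
- have maB : measurable (a @^-1` B) by rewrite -[X in measurable X]setTI; exact: ma.
  have mbB : measurable (b @^-1` B) by rewrite -[X in measurable X]setTI; exact: mb.
  transitivity (fine (P (a @^-1` B))); first exact: (integral_bm_indic P maB).
  by rewrite abP//; apply: esym; exact: (integral_bm_indic Q mbB).
- by rewrite !integral_bmZ ?IH//; [exact: bb|exact: ba].
- by rewrite !integral_bmD ?IHg ?IHh//; [exact: bb|exact: bb|exact: ba|exact: ba].
- apply/eqP; rewrite -subr_eq0 -normr_le0; apply/ler_addgt0Pl => e e0.
  rewrite addr0; have e20 : 0 < e / 2 by rewrite divr_gt0.
  have [h [bh IHh] gh] := gP _ e20.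
  have := integral_bm_dist P (ba _ bg) (ba _ bh) (fun x => gh (a x)).
  have := integral_bm_dist Q (bb _ bg) (bb _ bh) (fun x => gh (b x)).
  rewrite IHh; set u := \int[P]_x _; set v := \int[Q]_y _; set w := \int[Q]_y _.
  by rewrite !ler_norml; lra.
Qed.

Lemma integral_prodM (P : probability T R) (Q : probability U R)
    (a : T -> R) (b : U -> R) :
  bounded_measurable a -> bounded_measurable b ->
  \int[(P \x Q)%E]_z (a z.1 * b z.2) = \int[P]_x a x * \int[Q]_y b y.
Proof.
move=> ba bb.
have bab : bounded_measurable (fun z : T * U => a z.1 * b z.2).
  apply: bounded_measurableM.
    exact: (bounded_measurable_comp measurable_fst).
  exact: (bounded_measurable_comp measurable_snd).
apply: EFin_inj; rewrite -(EFin_integral_bm (P \x Q)%E)//.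
rewrite -integral12_prod_meas1; last exact: (bounded_measurable_integrable (P \x Q)%E).
transitivity (\int[P]_x (a x * \int[Q]_y b y)%:E)%E.
  apply: eq_integral => x _; rewrite /fubini_F/= (EFin_integral_bm Q)//.
    by rewrite integral_bmZ.
  exact: bounded_measurableZ.
rewrite EFin_integral_bm//; last first.
  by apply: bounded_measurableM => //; exact: bounded_measurable_cst.
under eq_Rintegral do rewrite mulrC.
by rewrite integral_bmZ// mulrC.
Qed.

Lemma ae_eq_of_integrals (P : probability T R) (g h : T -> R) :
  bounded_measurable g -> bounded_measurable h ->
  (forall A, measurable A ->
    \int[P]_x ((\1_A : T -> R) x * g x) = \int[P]_x ((\1_A : T -> R) x * h x)) ->
  {ae P, forall x, g x = h x}.
Proof.
move=> bg bh gh.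
have restrE A (u : T -> R) : measurable A -> bounded_measurable u ->
    (\int[P]_(x in A) (u x)%:E)%E = (\int[P]_x ((\1_A : T -> R) x * u x))%:E.
  move=> mA bu; rewrite EFin_integral_bm// Rintegral_mkcond; congr (_%:E).
  apply: eq_Rintegral => x _; rewrite patchE indicE.
  by case: (_ \in _); rewrite ?mul1r ?mul0r.
have := @integral_ae_eq _ T R P setT measurableT (EFin \o h) (EFin \o g).
have ig := bounded_measurable_integrable P measurableT bg.
have mh : measurable_fun setT (EFin \o h) by apply/measurable_EFinP; case: bh.
move=> /(_ ig mh); case.
  by move=> A _ mA; rewrite /= !restrE// gh.
by move=> N [mN N0 NP]; exists N; split=> // x /= gxh; apply: NP => /= /(_ I)[].
Qed.

Lemma ae_eq_integral_bm (P : probability T R) (g h : T -> R) :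
  bounded_measurable g -> bounded_measurable h ->
  {ae P, forall x, g x = h x} -> \int[P]_x g x = \int[P]_x h x.
Proof.
move=> bg bh gh; rewrite /Rintegral; congr fine.
apply: ae_eq_integral => //.
- by apply/measurable_EFinP; case: bg.
- by apply/measurable_EFinP; case: bh.
- by apply: filterS gh => x -> _.
Qed.

End integral_transfer.

(** * Characters under Haar measure and convolution *)

Section torus_integrals.
Context {R : realType} {d : nat}.
Local Notation K := (torus R d).
Implicit Types m : 'rV[int]_d.

Lemma torus_cos_bounded_measurable m : bounded_measurable (torus_cos m : K -> R).
Proof.
split; last by exists 1 => x; exact: circle_cos_max.
exact: torus_continuous_measurable (torus_cos_sin_continuous m).1.
Qed.

Lemma torus_sin_bounded_measurable m : bounded_measurable (torus_sin m : K -> R).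
Proof.
split; last by exists 1 => x; exact: circle_sin_max.
exact: torus_continuous_measurable (torus_cos_sin_continuous m).2.
Qed.

Lemma trig_bounded_measurable (p : K -> R) : trig_poly p -> bounded_measurable p.
Proof.
move=> tp; split; last by have [M _ pM] := trig_bounded tp; exists M.
exact: torus_continuous_measurable (trig_continuous tp).
Qed.

Lemma torus_cosD m (x y : K) : torus_cos m (x + y) =
  torus_cos m x * torus_cos m y - torus_sin m x * torus_sin m y.
Proof. by rewrite /torus_cos torus_charD circle_cosD. Qed.

Lemma torus_sinD m (x y : K) : torus_sin m (x + y) =
  torus_sin m x * torus_cos m y + torus_cos m x * torus_sin m y.
Proof. by rewrite /torus_sin torus_charD circle_sinD. Qed.

Lemma haar_translate (haar : probability K R) (a : K) (g : K -> R) :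
  is_haar haar -> bounded_measurable g ->
  \int[haar]_x g x = \int[haar]_x g (a + x).
Proof.
move=> haarP bg; apply: (@integral_same_law _ _ _ _ _ _ _ haar haar id) => //.
  exact: torus_translation_measurable.
move=> B mB; rewrite -[LHS](haarP (- a) B mB); congr (haar _).
apply/seteqP; split=> [_ [x Bx <-]|x Bax] /=; first by rewrite addrA subrr add0r.
by exists (a + x) => //; rewrite addrA addNr add0r.
Qed.

(** Translating by a point where the character takes the value [-1] changes the
    sign of its cosine and sine. *)
Lemma haar_integral_char (haar : probability K R) m : is_haar haar -> m != 0 ->
  \int[haar]_x torus_cos m x = 0 /\ \int[haar]_x torus_sin m x = 0.
Proof.
move=> haarP m0; have [a am] := torus_char_surj (\pi_(circle R)%qT 2^-1) m0.
have turn_half : pi *+ 2 * 2^-1 = pi :> R by rewrite -[pi *+ 2]mulr_natr mulfK.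
have ca : torus_cos m a = -1 by rewrite /torus_cos am circle_cosE turn_half cospi.
have sa : torus_sin m a = 0 by rewrite /torus_sin am circle_sinE turn_half sinpi.
have bc := torus_cos_bounded_measurable m; have bs := torus_sin_bounded_measurable m.
split.
  have : \int[haar]_x torus_cos m x = -1 * \int[haar]_x torus_cos m x.
    rewrite {1}(haar_translate a haarP bc) -integral_bmZ//.
    by apply: eq_Rintegral => x _; rewrite torus_cosD ca sa mul0r subr0.
  lra.
have : \int[haar]_x torus_sin m x = -1 * \int[haar]_x torus_sin m x.
  rewrite {1}(haar_translate a haarP bs) -integral_bmZ//.
  by apply: eq_Rintegral => x _; rewrite torus_sinD ca sa mul0r add0r.
lra.
Qed.

Section convolution.
Variables P Q S : probability K R.
Hypothesis S_convolution : forall B, measurable B -> S B = convolution P Q B.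

(** The laws of [g] and of [g (z.1 + z.2)] on the line are compared; the
    measurability of the latter function will come from the addition formulas.
    Integrating the bounded function
    [clamp] against these laws gives the two sides. *)
Lemma convolution_integral (g : K -> R) : measurable_fun setT g ->
  (forall x, `|g x| <= 1) ->
  measurable_fun setT (fun z : K * K => g (z.1 + z.2)) ->
  \int[S]_x g x = \int[(P \x Q)%E]_z g (z.1 + z.2).
Proof.
move=> mg g1 mgD.
pose clamp (r : R) := Num.max (- 1) (Num.min r 1).
have bclamp : bounded_measurable clamp.
  split.
    by apply: measurable_maxr => //; apply: measurable_minr.
  exists 1 => r; rewrite ler_norml /clamp le_max lexx/= ge_max ge_min lexx orbT andbT.
  by lra.
have clampE x : clamp (g x) = g x.
  have := g1 x; rewrite ler_norml => /andP[g1' g2'].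
  by rewrite /clamp (min_idPl _)// (max_idPr _).
transitivity (\int[S]_x clamp (g x)); first by apply: eq_Rintegral => x _; rewrite clampE.
transitivity (\int[(P \x Q)%E]_z clamp (g (z.1 + z.2))); last first.
  by apply: eq_Rintegral => z _; rewrite clampE.
apply: (@integral_same_law _ _ _ _ _ _ _ S (P \x Q)%E g (fun z => g (z.1 + z.2))) => //.
move=> B mB; rewrite S_convolution//.
by rewrite -[X in measurable X]setTI; exact: mg.
Qed.

Lemma convolution_cos m : \int[S]_x torus_cos m x =
  (\int[P]_x torus_cos m x) * (\int[Q]_x torus_cos m x) -
  (\int[P]_x torus_sin m x) * (\int[Q]_x torus_sin m x).
Proof.
have bc := torus_cos_bounded_measurable m; have bs := torus_sin_bounded_measurable m.
have bcc : bounded_measurable (fun z : K * K => torus_cos m z.1 * torus_cos m z.2).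
  apply: bounded_measurableM; [exact: (bounded_measurable_comp measurable_fst bc)|].
  exact: (bounded_measurable_comp measurable_snd bc).
have bss : bounded_measurable (fun z : K * K => torus_sin m z.1 * torus_sin m z.2).
  apply: bounded_measurableM; [exact: (bounded_measurable_comp measurable_fst bs)|].
  exact: (bounded_measurable_comp measurable_snd bs).
rewrite convolution_integral.
- rewrite -!integral_prodM// -integral_bmB//.
  by apply: eq_Rintegral => z _; rewrite torus_cosD.
- by case: bc.
- by move=> x; exact: circle_cos_max.
- by under eq_fun do rewrite torus_cosD; exact: (bounded_measurableB bcc bss).1.
Qed.

Lemma convolution_sin m : \int[S]_x torus_sin m x =
  (\int[P]_x torus_sin m x) * (\int[Q]_x torus_cos m x) +
  (\int[P]_x torus_cos m x) * (\int[Q]_x torus_sin m x).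
Proof.
have bc := torus_cos_bounded_measurable m; have bs := torus_sin_bounded_measurable m.
have bsc : bounded_measurable (fun z : K * K => torus_sin m z.1 * torus_cos m z.2).
  apply: bounded_measurableM; [exact: (bounded_measurable_comp measurable_fst bs)|].
  exact: (bounded_measurable_comp measurable_snd bc).
have bcs : bounded_measurable (fun z : K * K => torus_cos m z.1 * torus_sin m z.2).
  apply: bounded_measurableM; [exact: (bounded_measurable_comp measurable_fst bc)|].
  exact: (bounded_measurable_comp measurable_snd bs).
rewrite convolution_integral.
- rewrite -!integral_prodM// -integral_bmD//.
  by apply: eq_Rintegral => z _; rewrite torus_sinD.
- by case: bs.
- by move=> x; exact: circle_sin_max.
- by under eq_fun do rewrite torus_sinD; exact: (bounded_measurableD bsc bcs).1.
Qed.

End convolution.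

End torus_integrals.

(** * Approximation of test functions *)

Section test_function_approximation.
Context {R : realType} {d : nat} {dI : measure_display} {I : measurableType dI}.
Local Notation K := (torus R d).
Variables (X : topologicalType) (phi : I -> X) (g : X * K -> R).
Hypothesis X_compact : compact [set: X].
Hypothesis phi_measurable : forall U : set X, open U -> measurable (phi @^-1` U).
Hypothesis g_continuous : continuous g.
Variable Q : set (I * K -> R).
Hypothesis Q_tensor : forall A p, measurable A -> trig_poly p ->
  Q (fun z => (\1_A : I -> R) z.1 * p z.2).
Hypothesis Q_add : forall h h', Q h -> Q h' -> Q (fun z => h z + h' z).

(** Approximate the section at [x] by a trigonometric polynomial; the bound
    extends to nearby points by compactness of the torus. *)
Lemma test_function_local (x : X) e : 0 < e -> exists2 p : K -> R, trig_poly p &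
  \forall x' \near x, forall y, `|g (x', y) - p y| < e.
Proof.
move=> e0; have e20 : 0 < e / 2 by rewrite divr_gt0.
have cgx : continuous (fun y : K => g (x, y)).
  move=> y; apply: (@continuous_comp K (X * K)%type R (fun y => (x, y)) g).
    by apply: (@cvg_pair _ _ _ (nbhs y) (nbhs x) (nbhs y)) => //; exact: cvg_cst.
  exact: g_continuous.
have [p tp pg] := trig_dense cgx e20; exists p => //.
have /compact_near_coveringP/(_ _ (nbhs x)
  (fun x' y => `|g (x', y) - p y| < e) _) := @torus_compact R d.
move=> h; have {h} : \forall x' \near x, [set: K] `<=` (fun y => `|g (x', y) - p y| < e).
  apply: h => y _.
  have cgp : continuous (fun z : K * X => `|g (z.2, z.1) - p z.1|).
    move=> z; apply: (@continuous_comp (K * X)%type R R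
      (fun z => g (z.2, z.1) - p z.1) (fun r => `|r|)); last exact: norm_continuous.
    have c1 : {for z, continuous (fun z : K * X => g (z.2, z.1))}.
      apply: (@continuous_comp (K * X)%type (X * K)%type R (fun z => (z.2, z.1)) g).
        by apply: (@cvg_pair _ _ _ (nbhs z) (nbhs z.2) (nbhs z.1));
          [exact: cvg_snd|exact: cvg_fst].
      exact: g_continuous.
    have c2 : {for z, continuous (fun z : K * X => p z.1)}.
      apply: (@continuous_comp (K * X)%type K R fst p); first exact: cvg_fst.
      exact: trig_continuous.
    exact: (cvgB c1 c2).
  have : `|g (x, y) - p y| < e by rewrite (lt_trans (pg y))// ltr_pdivrMr// ltr_pMr// ltr1n.
  move=> /lt_nbhsl; exact: (cgp (y, x)).
by apply: filterS => x' h y; exact: h.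
Qed.

(** A set [V] is good when test functions can be approximated over every
    measurable part of the preimage of [V], by a function of [Q] that vanishes
    elsewhere.  This localized form makes good sets stable under union, since a
    part of a union splits into two disjoint measurable pieces.  Small open sets
    are good, hence so is [X] by compactness, again applied to a filter of upper
    sections. *)
Lemma test_function_approx e : 0 < e ->
  exists2 h, Q h & forall z, `|g (phi z.1, z.2) - h z| <= e.
Proof.
move=> e0.
pose good (V : set X) := measurable (phi @^-1` V) /\
  forall A, measurable A -> A `<=` phi @^-1` V -> exists2 h, Q h &
    forall z, (A z.1 -> `|g (phi z.1, z.2) - h z| <= e) /\ (~ A z.1 -> h z = 0).
have good0 : good set0.
  split; first by rewrite preimage_set0.
  move=> A mA A0; exists (fun z => (\1_A : I -> R) z.1 * cst 0 z.2).
    by apply: Q_tensor => //; exact: trig_cst.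
  by move=> z; rewrite mulr0; split=> // /A0.
have goodU V W : good V -> good W -> good (V `|` W).
  move=> [mV gV] [mW gW]; split; first by rewrite preimage_setU; exact: measurableU.
  move=> A mA AVW.
  have [||h Qh hP] := gV (A `&` phi @^-1` V); [exact: measurableI|by move=> ? []|].
  have [||h' Qh' hP'] := gW (A `\` phi @^-1` V).
  - exact: measurableD.
  - by move=> x [Ax nVx]; case: (AVW _ Ax).
  exists (fun z => h z + h' z); first exact: Q_add.
  move=> z; have [h1 h2] := hP z; have [h1' h2'] := hP' z; split=> [Az|nAz].
    have [Vz|nVz] := pselect (V (phi z.1)).
      by rewrite h2' ?addr0; [exact: h1|case].
    by rewrite h2 ?add0r; [exact: h1'|case].
  by rewrite h2 ?h2' ?addr0//; case.
pose up (V : set X) := [set V' | good V' /\ V `<=` V'].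
have up_filter : Filter (filter_from good up).
  apply: filter_from_filter; first by exists set0.
  move=> V W gV gW; exists (V `|` W); first exact: goodU.
  by move=> U [gU VWU]; split; split=> // x xV; apply: VWU; [left|right].
have /compact_near_coveringP/(_ _ (filter_from good up)
  (fun V x => V x) up_filter) := X_compact.
case.
  move=> x _; have [p tp] := test_function_local x e0.
  rewrite /prop_near1 nbhsE => -[U [oU Ux] Up].
  have mU := phi_measurable oU.
  have gU : good U.
    split=> // A mA AU; exists (fun z => (\1_A : I -> R) z.1 * p z.2); first exact: Q_tensor.
    move=> z; rewrite indicE; split=> Az; last by rewrite memNset// mul0r.
    by rewrite mem_set// mul1r; exact/ltW/Up/AU.
  exists (U, up U); first by split=> /=; [exact: open_nbhs_nbhs|exists U].
  by move=> [x' V] /= [Ux' [_ UV]]; exact: UV.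
move=> V [mV gV] gVP.
have VT : V = setT.
  apply/seteqP; split=> // x _; exact: (gVP V (conj (conj mV gV) (@subset_refl _ V)) x Logic.I).
have [|h Qh hP] := gV setT measurableT; first by rewrite VT.
by exists h => // z; have [h1 _] := hP z; exact: h1.
Qed.

End test_function_approximation.

(** * Equidistribution along a set of density one *)

Section equidistribution.
Context {R : realType} {d : nat} {dI : measure_display} {I : measurableType dI}.
Local Notation K := (torus R d).
Variables (L : probability I R) (f : {mfun I >-> K}).
Implicit Types m : 'rV[int]_d.

(** The fiber over [c] is the preimage under [f] of a coset of the kernel of the
    character, a closed subgroup which is proper because nonzero characters are
    onto. *)
Lemma asynchronous_char_atomless m c : asynchronous L f -> m != 0 ->
  L [set x | torus_char m (f x) = c] = 0%E.
Proof.
move=> async m0; have [a am] := torus_char_surj c m0.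
pose H := [set x : K | torus_char m x = 0].
have H_subgroup : closed_subgroup H.
  split.
  - have -> : H = torus_cos m @^-1` [set 1].
      apply/seteqP; split=> x; rewrite /H /torus_cos /=.
        by move=> ->; exact: circle_cos0.
      exact: circle_cos_eq1.
    apply: preimage_closed; last exact: closed_eq.
    by move=> x _; exact: (torus_cos_sin_continuous m).1.
  - exact: torus_char0r.
  - by move=> x y Hx Hy; rewrite /H /= torus_charD torus_charN Hx Hy subrr.
have H_proper : H <> setT.
  move=> HT; have [b bm] := torus_char_surj (\pi_(circle R)%qT 2^-1) m0.
  have : H b by rewrite HT.
  rewrite /H /= bm => /(congr1 circle_cos); rewrite circle_cos0 circle_cosE.
  by rewrite -[pi *+ 2]mulr_natr mulfK// cospi; lra.
rewrite -[RHS](async H H_subgroup H_proper a); congr (L _).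
apply/seteqP; split=> x /=.
  move=> xc; exists (f x - a); last by rewrite addrC subrK.
  by rewrite /H /= torus_charD torus_charN xc am subrr.
by move=> [h Hh <-]; rewrite torus_charD am Hh addr0.
Qed.

Lemma char_cos_measurable m (n : int) :
  measurable_fun setT (fun x => circle_cos (torus_char m (f x) *~ n)).
Proof.
under eq_fun do rewrite -torus_char_mulz.
apply: (@measurableT_comp _ _ _ _ _ _ (torus_cos m) _ (mulz_fun f n)).
  by have [] := torus_cos_bounded_measurable (R := R) m.
exact: measurable_funPT.
Qed.

Lemma char_sin_measurable m (n : int) :
  measurable_fun setT (fun x => circle_sin (torus_char m (f x) *~ n)).
Proof.
under eq_fun do rewrite -torus_char_mulz.
apply: (@measurableT_comp _ _ _ _ _ _ (torus_sin m) _ (mulz_fun f n)).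
  by have [] := torus_sin_bounded_measurable (R := R) m.
exact: measurable_funPT.
Qed.

Local Notation coef m := (cos_coef L (fun x => torus_char m (f x))).

(** The pairs [(m, k)] form a countable type, so that one density-one set handles
    all of them. *)
Lemma asynchronous_density_set : asynchronous L f ->
  exists E : set int, full_density R E /\
    forall m k, m != 0 -> coef m (n + k) @[n --> to_infty_in E] --> (0 : R).
Proof.
move=> async.
pose a j n := if unpickle j is Some (m, k) then
  if m != 0 then coef m (n + k) ^+ 2 else 0 else 0 : R.
have coef_le1 m n : `|coef m n| <= 1.
  apply: norm_integral_bm => [|x]; last exact: circle_cos_max.
  by split; [exact: char_cos_measurable|exists 1 => x; exact: circle_cos_max].
have [j n|j|E [dE aE]] := @koopman_von_neumann_family R a.
- rewrite /a; case: (unpickle j) => [[m k]|]; last by rewrite lexx ler01.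
  case: ifP => _; last by rewrite lexx ler01.
  by rewrite sqr_ge0/= -real_normK ?num_real// expr_le1// coef_le1.
- rewrite /a; case: (unpickle j) => [[m k]|]; last first.
    by under eq_fun do rewrite centered_mean_cst; exact: cvg_cst.
  case: (eqVneq m 0) => [_|m0] /=.
    by under eq_fun do rewrite centered_mean_cst; exact: cvg_cst.
  apply: wiener => [n|n|c]; [exact: char_cos_measurable|exact: char_sin_measurable|].
  exact: asynchronous_char_atomless.
exists E; split=> // m k m0.
have := aE (pickle (m, k)); rewrite /a pickleK m0 => sq_cvg0.
apply/cvgr0Pnorm_lt => e e0.
have e20 : 0 < e ^+ 2 by rewrite exprn_gt0.
move/cvgr0Pnorm_lt : sq_cvg0 => /(_ _ e20); apply: filterS => n.
by rewrite normrX ltr_pXn2r// nnegrE// ltW.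
Qed.

Lemma char_weakly_null (E : set int) m (h : I -> R) :
  (forall k, coef m (n + k) @[n --> to_infty_in E] --> (0 : R)) ->
  bounded_measurable h ->
  \int[L]_x (h x * circle_cos (torus_char m (f x) *~ n)) @[n --> to_infty_in E] --> (0 : R) /\
  \int[L]_x (h x * circle_sin (torus_char m (f x) *~ n)) @[n --> to_infty_in E] --> (0 : R).
Proof.
move=> coef0 bh.
have bc n : bounded_measurable (fun x => circle_cos (torus_char m (f x) *~ n)).
  by split; [exact: char_cos_measurable|exists 1 => x; exact: circle_cos_max].
split; apply: almost_orthogonal_weakly_null => //.
- by move=> n; exact: char_cos_measurable.
- by move=> n x; exact: circle_cos_max.
- move=> k; have -> : (fun n => \int[L]_x (circle_cos (torus_char m (f x) *~ k) *
      circle_cos (torus_char m (f x) *~ n))) =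
      (fun n => 2^-1 * (coef m (n + k) + coef m (n + - k))).
    apply/funext => n; rewrite -integral_bmD// -integral_bmZ; last exact: bounded_measurableD.
    apply: eq_Rintegral => x _.
    by rewrite !mulrzDr mulrNz !circle_cosD circle_cosN circle_sinN; field.
  have := cvgM (cvg_cst (2^-1 : R)) (cvgD (coef0 k) (coef0 (- k))).
  by rewrite addr0 mulr0 => h'; exact: h'.
- by move=> n; exact: char_sin_measurable.
- by move=> n x; exact: circle_sin_max.
- move=> k; have -> : (fun n => \int[L]_x (circle_sin (torus_char m (f x) *~ k) *
      circle_sin (torus_char m (f x) *~ n))) =
      (fun n => 2^-1 * (coef m (n + - k) - coef m (n + k))).
    apply/funext => n; rewrite -integral_bmB// -integral_bmZ; last exact: bounded_measurableB.
    apply: eq_Rintegral => x _.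
    by rewrite !mulrzDr mulrNz !circle_cosD circle_cosN circle_sinN; field.
  have := cvgM (cvg_cst (2^-1 : R)) (cvgB (coef0 (- k)) (coef0 k)).
  by rewrite subrr mulr0 => h'; exact: h'.
Qed.

(** The fibers of the graph measure are Dirac masses.  Comparing integrals of one
    function [t] at a time reduces this to the almost sure equality of two
    functions of [x], which follows from their integrals over measurable sets. *)
Lemma graph_kernel_integral (n : int) (k : R.-pker I ~> K) (t : K -> R) :
  disintegration (graph_measure L (mulz_fun f n)) k -> bounded_measurable t ->
  {ae L, forall x, kernel_integral k t x = t (f x *~ n)}.
Proof.
move=> kP bt.
have mn : measurable_fun setT (fun x => f x *~ n).
  exact: (@measurable_funPT _ _ _ _ (mulz_fun f n)).
apply: ae_eq_of_integrals => [||A mA].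
- exact: kernel_integral_measurable.
- exact: (bounded_measurable_comp mn bt).
rewrite -(disintegration_integral kP)//.
have mgr : measurable_fun setT (fun x => (x, f x *~ n)).
  exact: measurable_fun_pair.
have bA : bounded_measurable (fun z : I * K => (\1_A : I -> R) z.1 * t z.2).
  apply: bounded_measurableM; last exact: (bounded_measurable_comp measurable_snd).
  exact/(bounded_measurable_comp measurable_fst)/bounded_measurable_indic.
exact: (@integral_same_law _ _ _ _ _ _ _ (graph_measure L (mulz_fun f n)) L id _ _
  _ mgr _ bA).
Qed.

Lemma kernel_integral_unique (mu : probability (I * K)%type R)
    (k k' : R.-pker I ~> K) (t : K -> R) :
  (forall A B, measurable A -> measurable B -> mu (A `*` B) = (\int[L]_(x in A) k x B)%E) ->
  (forall A B, measurable A -> measurable B -> mu (A `*` B) = (\int[L]_(x in A) k' x B)%E) ->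
  bounded_measurable t ->
  {ae L, forall x, kernel_integral k t x = kernel_integral k' t x}.
Proof.
move=> kP k'P bt; apply: ae_eq_of_integrals => [||A mA].
- exact: kernel_integral_measurable.
- exact: kernel_integral_measurable.
by rewrite -(disintegration_integral kP)// -(disintegration_integral k'P).
Qed.

End equidistribution.

Section fiberwise_convolution.
Context {R : realType} {d : nat} {dI : measure_display} {I : measurableType dI}.
Local Notation K := (torus R d).
Variables (L : probability I R) (f : {mfun I >-> K}).
Variables (mu rho : fibered d L) (n : int) (k0 : R.-pker I ~> K).
Hypothesis rhoP : is_fiberwise_convolution (graph_measure L (mulz_fun f n)) mu rho.
Hypothesis k0P : disintegration mu k0.
Implicit Types m : 'rV[int]_d.

Let convolution_kernel_prob (km kn kr : R.-pker I ~> K) x :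
  (forall B, measurable B -> kr x B = convolution (km x) (kn x) B) ->
  forall B, measurable B ->
    kernel_prob kr x B = convolution (kernel_prob km x) (kernel_prob kn x) B.
Proof. by move=> conv B mB; rewrite /kernel_prob conv. Qed.

Let ae_conj (P Q : I -> Prop) : {ae L, forall x, P x} -> {ae L, forall x, Q x} ->
  {ae L, forall x, P x /\ Q x}.
Proof. by move=> Px Qx; apply: filterS2 Px Qx. Qed.

Let twisted_bounded_measurable A (t : K -> R) (u : circle R -> R) m : measurable A ->
  bounded_measurable t ->
  measurable_fun setT (fun x => u (torus_char m (f x) *~ n)) ->
  (forall c, `|u c| <= 1) ->
  bounded_measurable (fun x => ((\1_A : I -> R) x * kernel_integral k0 t x) *
    u (torus_char m (f x) *~ n)).
Proof.
move=> mA bt mut u1; apply: bounded_measurableM.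
  apply: bounded_measurableM; first exact: bounded_measurable_indic.
  exact: kernel_integral_measurable.
by split=> //; exists 1.
Qed.

(** In each fiber, the cosine integrates against the convolution as in the
    addition formula, the fiber of the graph measure being the Dirac mass at
    [f x *~ n].  The kernel [k0] of [mu] is fixed once and for all, whereas the
    kernels given by [rhoP] depend on [n]. *)
Lemma fiberwise_convolution_cos A m : measurable A ->
  \int[rho]_z ((\1_A : I -> R) z.1 * torus_cos m z.2) =
  \int[L]_x (((\1_A : I -> R) x * kernel_integral k0 (torus_cos m) x) *
    circle_cos (torus_char m (f x) *~ n)) -
  \int[L]_x (((\1_A : I -> R) x * kernel_integral k0 (torus_sin m) x) *
    circle_sin (torus_char m (f x) *~ n)).
Proof.
move=> mA; have [km [kn [kr [kmP knP krP conv]]]] := rhoP.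
have bc := torus_cos_bounded_measurable (R := R) m.
have bs := torus_sin_bounded_measurable (R := R) m.
have b1 := twisted_bounded_measurable mA bc (char_cos_measurable f m n)
  (@circle_cos_max R).
have b2 := twisted_bounded_measurable mA bs (char_sin_measurable f m n)
  (@circle_sin_max R).
rewrite -integral_bmB// (disintegration_integral krP)//.
apply: ae_eq_integral_bm => //.
- apply: bounded_measurableM; first exact: bounded_measurable_indic.
  exact: kernel_integral_measurable.
- exact: bounded_measurableB.
have nc_ae := kernel_integral_unique knP k0P bc.
have ns_ae := kernel_integral_unique knP k0P bs.
have kc_ae := graph_kernel_integral kmP bc.
have ks_ae := graph_kernel_integral kmP bs.
apply: filterS3 (ae_conj nc_ae ns_ae) conv (ae_conj kc_ae ks_ae).
move=> x [nc ns] xconv [kc ks].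
have -> : kernel_integral kr (torus_cos m) x =
    kernel_integral km (torus_cos m) x * kernel_integral kn (torus_cos m) x -
    kernel_integral km (torus_sin m) x * kernel_integral kn (torus_sin m) x.
  exact: (convolution_cos (P := kernel_prob km x) (Q := kernel_prob kn x)
    (S := kernel_prob kr x) (convolution_kernel_prob xconv)).
rewrite kc ks nc ns /torus_cos /torus_sin torus_char_mulz; ring.
Qed.

Lemma fiberwise_convolution_sin A m : measurable A ->
  \int[rho]_z ((\1_A : I -> R) z.1 * torus_sin m z.2) =
  \int[L]_x (((\1_A : I -> R) x * kernel_integral k0 (torus_cos m) x) *
    circle_sin (torus_char m (f x) *~ n)) +
  \int[L]_x (((\1_A : I -> R) x * kernel_integral k0 (torus_sin m) x) *
    circle_cos (torus_char m (f x) *~ n)).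
Proof.
move=> mA; have [km [kn [kr [kmP knP krP conv]]]] := rhoP.
have bc := torus_cos_bounded_measurable (R := R) m.
have bs := torus_sin_bounded_measurable (R := R) m.
have b1 := twisted_bounded_measurable mA bc (char_sin_measurable f m n)
  (@circle_sin_max R).
have b2 := twisted_bounded_measurable mA bs (char_cos_measurable f m n)
  (@circle_cos_max R).
rewrite -integral_bmD// (disintegration_integral krP)//.
apply: ae_eq_integral_bm => //.
- apply: bounded_measurableM; first exact: bounded_measurable_indic.
  exact: kernel_integral_measurable.
- exact: bounded_measurableD.
have nc_ae := kernel_integral_unique knP k0P bc.
have ns_ae := kernel_integral_unique knP k0P bs.
have kc_ae := graph_kernel_integral kmP bc.
have ks_ae := graph_kernel_integral kmP bs.
apply: filterS3 (ae_conj nc_ae ns_ae) conv (ae_conj kc_ae ks_ae).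
move=> x [nc ns] xconv [kc ks].
have -> : kernel_integral kr (torus_sin m) x =
    kernel_integral km (torus_sin m) x * kernel_integral kn (torus_cos m) x +
    kernel_integral km (torus_cos m) x * kernel_integral kn (torus_sin m) x.
  exact: (convolution_sin (P := kernel_prob km x) (Q := kernel_prob kn x)
    (S := kernel_prob kr x) (convolution_kernel_prob xconv)).
rewrite kc ks nc ns /torus_cos /torus_sin torus_char_mulz; ring.
Qed.

End fiberwise_convolution.

Section limit.
Context {R : realType} {d : nat} {dI : measure_display} {I : measurableType dI}.
Local Notation K := (torus R d).
Variables (L : probability I R) (f : {mfun I >-> K}) (haar : probability K R).
Hypothesis haarP : is_haar haar.
Variable E : set int.
Hypothesis E_coef : forall m k, m != 0 ->
  cos_coef L (fun x => torus_char m (f x)) (n + k) @[n --> to_infty_in E] --> (0 : R).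
Variables (mu : fibered d L) (rho : int -> fibered d L).
Hypothesis rhoP : forall n : int,
  is_fiberwise_convolution (graph_measure L (mulz_fun f n)) mu (rho n).

Definition equidistributed (h : I * K -> R) : Prop :=
  bounded_measurable h /\
  (\int[rho n]_z h z)%R @[n --> to_infty_in E] --> (\int[product_fibered L haar]_z h z)%R.

Lemma equidistributedD h h' : equidistributed h -> equidistributed h' ->
  equidistributed (fun z => h z + h' z).
Proof.
move=> [bh hP] [bh' h'P]; split; first exact: bounded_measurableD.
under eq_fun do rewrite integral_bmD//.
by rewrite integral_bmD//; exact: cvgD.
Qed.

Lemma equidistributedZ c h : equidistributed h -> equidistributed (fun z => c * h z).
Proof.
move=> [bh hP]; split; first exact: bounded_measurableZ.
under eq_fun do rewrite integral_bmZ//.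
by rewrite integral_bmZ//; exact: cvgM (cvg_cst c) hP.
Qed.

Lemma equidistributed_limit (g : I * K -> R) : measurable_fun setT g ->
  (forall e, 0 < e -> exists2 h, equidistributed h & forall z, `|g z - h z| <= e) ->
  equidistributed g.
Proof.
move=> mg gP.
have bg : bounded_measurable g.
  split=> //; have [h [[_ [M hM]] _] gh] := gP 1 ltr01.
  exists (1 + M) => z; rewrite -(subrK (h z) (g z)).
  by rewrite (le_trans (ler_normD _ _))// lerD.
split=> //; apply/cvgrPdist_lt => e e0.
have e30 : 0 < e / 3 by rewrite divr_gt0.
have [h [bh hP] gh] := gP _ e30.
move/cvgrPdist_lt : hP => /(_ _ e30); apply: filterS => n.
have := integral_bm_dist (product_fibered L haar) bg bh gh.
have := integral_bm_dist (rho n) bg bh gh.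
set a := \int[_]_z _; set b := \int[_]_z _; set a' := \int[_]_z _; set b' := \int[_]_z _.
by rewrite !ler_norml !ltr_norml; lra.
Qed.

Lemma fibered_marginal_integral (nu : fibered d L) A : measurable A ->
  \int[nu]_z ((\1_A : I -> R) z.1) = fine (L A).
Proof.
move=> mA; rewrite -(fibered_marginal nu mA).
have mfA : measurable (fst @^-1` A : set (I * K)).
  by rewrite -[X in measurable X]setTI; exact: measurable_fst.
exact: (integral_bm_indic nu mfA).
Qed.

(** The trivial character is constant, and constants only see the common marginal
    [L]; for the other characters both the limit and the integral against the
    product measure vanish. *)
Lemma equidistributed_tensor A p : measurable A -> trig_poly p ->
  equidistributed (fun z => (\1_A : I -> R) z.1 * p z.2).
Proof.
move=> mA tp.
have bAp q : trig_poly q -> bounded_measurable (fun z : I * K => (\1_A : I -> R) z.1 * q z.2).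
  move=> tq; apply: bounded_measurableM.
    exact/(bounded_measurable_comp measurable_fst)/bounded_measurable_indic.
  exact/(bounded_measurable_comp measurable_snd)/trig_bounded_measurable.
have cstP c : equidistributed (fun z => (\1_A : I -> R) z.1 * cst c z.2).
  split; first exact/bAp/trig_cst.
  have intE (nu : fibered d L) : \int[nu]_z ((\1_A : I -> R) z.1 * cst c z.2) = c * fine (L A).
    rewrite -(fibered_marginal_integral nu mA) -integral_bmZ.
      by apply: eq_Rintegral => z _; rewrite mulrC.
    exact/(bounded_measurable_comp measurable_fst)/bounded_measurable_indic.
  by under eq_fun do rewrite intE; rewrite intE; exact: cvg_cst.
have b1A := bounded_measurable_indic (R := R) mA.
have [k0 k0P] : exists k0, disintegration mu k0.
  by have [km [kn [kr [_ knP _ _]]]] := rhoP 0; exists kn.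
elim: tp => [m|m|q q' tq IHq tq' IHq'|c q tq IHq].
- have [->|m0] := eqVneq m 0.
    have -> : torus_cos (0 : 'rV[int]_d) = cst 1 :> (K -> R).
      by apply/funext => x; rewrite /torus_cos torus_char0l circle_cos0.
    exact: cstP.
  have bc := torus_cos_bounded_measurable (R := R) m.
  have bs := torus_sin_bounded_measurable (R := R) m.
  split; first exact/bAp/trig_cos.
  under eq_fun do rewrite (fiberwise_convolution_cos (rhoP _) k0P)//.
  rewrite (integral_prodM L haar b1A bc) (haar_integral_char haarP m0).1 mulr0.
  have [c0 _] := char_weakly_null (fun k => E_coef k m0)
    (bounded_measurableM b1A (kernel_integral_measurable k0 bc)).
  have [_ s0] := char_weakly_null (fun k => E_coef k m0)
    (bounded_measurableM b1A (kernel_integral_measurable k0 bs)).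
  by have lim0 := cvgB c0 s0; rewrite subrr in lim0; exact: lim0.
- have [->|m0] := eqVneq m 0.
    have -> : torus_sin (0 : 'rV[int]_d) = cst 0 :> (K -> R).
      by apply/funext => x; rewrite /torus_sin torus_char0l circle_sin0.
    exact: cstP.
  have bc := torus_cos_bounded_measurable (R := R) m.
  have bs := torus_sin_bounded_measurable (R := R) m.
  split; first exact/bAp/trig_sin.
  under eq_fun do rewrite (fiberwise_convolution_sin (rhoP _) k0P)//.
  rewrite (integral_prodM L haar b1A bs) (haar_integral_char haarP m0).2 mulr0.
  have [_ s0] := char_weakly_null (fun k => E_coef k m0)
    (bounded_measurableM b1A (kernel_integral_measurable k0 bc)).
  have [c0 _] := char_weakly_null (fun k => E_coef k m0)
    (bounded_measurableM b1A (kernel_integral_measurable k0 bs)).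
  by have lim0 := cvgD s0 c0; rewrite addr0 in lim0; exact: lim0.
- have -> : (fun z : I * K => (\1_A : I -> R) z.1 * (q \+ q') z.2) =
      (fun z => (\1_A : I -> R) z.1 * q z.2 + (\1_A : I -> R) z.1 * q' z.2).
    by apply/funext => z; rewrite mulrDr.
  exact: equidistributedD.
- have -> : (fun z : I * K => (\1_A : I -> R) z.1 * (c \*o q) z.2) =
      (fun z => c * ((\1_A : I -> R) z.1 * q z.2)).
    by apply/funext => z; rewrite mulrCA.
  exact: equidistributedZ.
Qed.

Lemma equidistributed_test_function (X : topologicalType) (phi : I -> X) (g : X * K -> R) :
  compact [set: X] -> borel_iso phi -> continuous g ->
  equidistributed (fun z => g (phi z.1, z.2)).
Proof.
move=> cX [_ phiP] cg.
have mphi U : open U -> measurable (phi @^-1` U).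
  by move=> oU; apply/phiP; exists U => //; exact: sub_sigma_algebra.
have gP e : 0 < e -> exists2 h, equidistributed h &
    forall z : I * K, `|g (phi z.1, z.2) - h z| <= e.
  by apply: (test_function_approx (Q := equidistributed) cX mphi cg);
    [exact: equidistributed_tensor|exact: equidistributedD].
apply: equidistributed_limit => //.
have /choice[h hP] n : exists h, equidistributed h /\
    forall z : I * K, `|g (phi z.1, z.2) - h z| <= n.+1%:R^-1.
  have n0 : 0 < n.+1%:R^-1 :> R by rewrite invr_gt0 ltr0n.
  by have [h ? ?] := gP _ n0; exists h.
apply: (@measurable_fun_cvg _ _ _ setT h) => [n|z _]; first by have [[[]]] := hP n.
apply/cvgrPdist_le => e e0.
have := @cvg_harmonic R; move=> /cvgr0Pnorm_le/(_ _ e0).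
apply: filterS => n; rewrite /= ger0_norm ?invr_ge0//; apply: le_trans.
by have [_] := hP n; apply.
Qed.

End limit.

Unset Implicit Arguments.

Theorem proposition3p3 (R : realType) (dI : measure_display)
    (I : measurableType dI) (L : probability I R) (d : nat)
    (f : {mfun I >-> torus R d}) (haar : probability (torus R d) R) :
  standard_borel R I -> atomless L -> (1 <= d)%N ->
  asynchronous L f -> is_haar haar ->
  exists E : set int, full_density R E /\
    forall (X : metricType R) (phi : I -> X),
      compact [set: X] -> borel_iso phi ->
    forall (mu : fibered d L) (rho : int -> fibered d L),
      (forall n : int,
        is_fiberwise_convolution (graph_measure L (mulz_fun f n)) mu (rho n)) ->
      (rho n : weak_star d L phi) @[n --> to_infty_in E] -->
        (product_fibered L haar : weak_star d L phi).
Proof.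
move=> _ _ _ async haarP.
have [E [dE E_coef]] := asynchronous_density_set async.
exists E; split=> // X phi cX phiP mu rho rhoP.
apply/cvg_weak_star => -[F cF].
have comp (c : R * R -> R) : continuous c ->
    (\int[rho n]_z c (F (phi z.1, z.2)))%R @[n --> to_infty_in E] -->
    (\int[product_fibered L haar]_z c (F (phi z.1, z.2)))%R.
  move=> cc; have cF' : continuous (fun z => c (F z)).
    by move=> z; apply: (@continuous_comp _ _ _ F c); [exact: cF|exact: cc].
  exact: (equidistributed_test_function haarP E_coef rhoP cX phiP cF').2.
have cvg1 := comp fst (fun z => @cvg_fst R R (nbhs z.1) (nbhs z.2) (nbhs_filter z.2)).
have cvg2 := comp snd (fun z => @cvg_snd R R (nbhs z.1) (nbhs z.2) (nbhs_filter z.1)).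
exact: (@cvg_pair _ _ _ _ (nbhs _) (nbhs _) _ _ _ _ _ cvg1 cvg2).
Qed.
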